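(* Let $N\ge 1$, $T>0$, $\varepsilon,\gamma>0$, and let $\zeta,\vartheta,F$, the initial positions $x_0^0<\dots<x_N^0$, the initial velocities $v_i^0\ge 0$ ($i\notin\Sigma^0$) and the leader trajectory $x_N$ satisfy the standing assumptions listed in the context. Then there exists a solution $x=(x_0,\dots,x_{N-1})\in C^{0,1}([0,T];\mathbb{R}^N)$ to the microscopic traffic model (in the sense defined in the context) satisfying, for $i=0,\dots,N-1$, $$\dot x_i(t)\le \widetilde v_i^0\vee\left(\frac{\bar\vartheta}{\gamma}\max_{[0,T]\times[x_0^0,x_N(T)]}F\right)\qquad\text{for almost every }t\in(0,T),$$ where $\widetilde v_i^0:=v_i^0$ if $i\notin\Sigma^0$, $\widetilde v_i^0:=0$ if $i\in\Sigma^0$, and $\bar\vartheta:=\max_{[0,\bar\rho_\vartheta]}\vartheta$. If in addition $x_N$ is strictly increasing and $F$ is positive, then $x_i$ is strictly increasing for all $i=0,\dots,N-1$.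
   Context: Notation: $a\vee b=\max\{a,b\}$; $\mathrm{int}$ denotes interior; $C^{0,1}$ denotes Lipschitz continuous functions. Standing assumptions. $F\in C^0([0,T]\times\mathbb{R})$ is nonnegative. $\zeta,\vartheta\in C^0([0,\infty))$ are nonnegative, and there are constants $\bar\rho_\vartheta\ge\bar\rho_\zeta>0$ with $\zeta(r)=0$ if and only if $r\ge\bar\rho_\zeta$, and $\vartheta(r)=0$ if and only if $r\ge\bar\rho_\vartheta$. The initial positions satisfy $x_0^0<x_1^0<\dots<x_N^0$ and $\rho_i^0:=\frac{1}{N(x_{i+1}^0-x_i^0)}\le\bar\rho_\vartheta$ for $i=0,\dots,N-1$. Set $\Sigma^0:=\{i\in\{0,\dots,N-1\}:\rho_i^0\in[\bar\rho_\zeta,\bar\rho_\vartheta]\}$. For $i\in\{0,\dots,N-1\}\setminus\Sigma^0$ (written $i\notin\Sigma^0$) an initial velocity $v_i^0\ge0$ is given. The function $x_N\in C^0([0,T])$ is given, nondecreasing, with $x_N(0)=x_N^0$. Solution to the microscopic traffic model. A function $x=(x_0,\dots,x_{N-1})\in C^{0,1}([0,T];\mathbb{R}^N)$ is a solution if, with $\rho_i(t):=\frac{1}{N(x_{i+1}(t)-x_i(t))}$ for $i=0,\dots,N-1$, the following hold for every $i=0,\dots,N-1$: (1) $x_i(0)=x_i^0$; (2) $t\mapsto x_i(t)$ is nondecreasing in $[0,T]$; (3) for all $t\in[0,T]$, $x_i(t)<x_{i+1}(t)$ and $\rho_i(t)\le\bar\rho_\vartheta$; (4) $x_i$ is of class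 $C^2$ in the (relatively) open set $\{t\in[0,T]:\rho_i(t)<\bar\rho_\zeta\}$ and therein solves $\varepsilon\zeta(\rho_i(t))\ddot x_i(t)+\gamma\dot x_i(t)=\vartheta(\rho_i(t))F(t,x_i(t))$; (5) $x_i$ is of class $C^1$ in the (relatively) open set $\{t\in[0,T]:\rho_i(t)\in(\bar\rho_\zeta,\bar\rho_\vartheta]\}\cup\mathrm{int}\{t\in[0,T]:\rho_i(t)=\bar\rho_\zeta\}$ and therein solves $\gamma\dot x_i(t)=\vartheta(\rho_i(t))F(t,x_i(t))$; (6) $\dot x_i(0)=v_i^0$ if $i\notin\Sigma^0$. *)

(* Defs.v *)
From HB Require Import structures.
From mathcomp Require Import all_boot all_order all_algebra.
From mathcomp Require Import all_classical all_reals all_analysis.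

Set Implicit Arguments.
Unset Strict Implicit.
Unset Printing Implicit Defensive.

Import Order.TTheory GRing.Theory Num.Theory.
Import numFieldNormedType.Exports.

Local Open Scope classical_set_scope.
Local Open Scope ring_scope.

(* Functions on [0, T] are total functions on R whose values outside [0, T]
   play no role.  Hence time derivatives are taken relative to [0, T]: two-sided
   at interior points, one-sided at 0 and at T. *)
Definition diff_quot (R : realType) (f : R -> R) (t : R) : R -> R :=
  fun s => (f s - f t) / (s - t).

Definition derivable_in (R : realType) (T : R) (f : R -> R) (t : R) : Prop :=
  cvg (diff_quot f t @ within `[0, T] t^').

(* Arbitrary value at t unless [derivable_in T f t]. *)
Definition dot (R : realType) (T : R) (f : R -> R) (t : R) : R :=
  lim (diff_quot f t @ within `[0, T] t^').

(* Intended for U relatively open in [0, T]. *)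
Definition C1_on (R : realType) (T : R) (U : set R) (f : R -> R) : Prop :=
  (forall t, U t -> derivable_in T f t) /\ {within U, continuous (dot T f)}.

Definition C2_on (R : realType) (T : R) (U : set R) (f : R -> R) : Prop :=
  C1_on T U f /\ C1_on T U (dot T f).

(* rho_i = 1 / (N (p_{i+1} - p_i)) for positions p_0, ..., p_N: under the
   coercion to nat, [lift ord0 i] is i + 1 and [widen_ord _ i] is i. *)
Definition density (R : realType) (N : nat) (p : 'I_N.+1 -> R) (i : 'I_N) : R :=
  (N%:R * (p (lift ord0 i) - p (widen_ord (leqnSn N) i)))^-1.

(* Positions at time t of the N followers and of the leader, of index N. *)
Definition positions (R : realType) (N : nat) (x : R -> 'rV[R]_N) (xN : R -> R)
    (t : R) : 'I_N.+1 -> R :=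
  fun j => if unlift ord_max j is Some i then x t ord0 i else xN t.

(* i \in Sigma^0 *)
Definition in_Sigma0 (R : realType) (N : nat) (rho_zeta rho_theta : R)
    (x0 : 'I_N.+1 -> R) (i : 'I_N) : bool :=
  rho_zeta <= density x0 i <= rho_theta.

Record is_solution (R : realType) (N : nat) (T eps gamma : R)
    (zeta theta : R -> R) (rho_zeta rho_theta : R) (F : R * R -> R)
    (x0 : 'I_N.+1 -> R) (v0 : 'I_N -> R) (xN : R -> R)
    (x : R -> 'rV[R]_N) : Prop := IsSolution {
  sol_lipschitz : exists k : R, k.-lipschitz_(`[0, T]) x ;
  sol_init : forall i, x 0 ord0 i = x0 (widen_ord (leqnSn N) i) ;
  sol_nondecreasing : forall i,
    {in `[0, T] &, {homo (fun t => x t ord0 i) : s t / s <= t}} ;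
  sol_order : forall i t, t \in `[0, T] ->
    x t ord0 i < positions x xN t (lift ord0 i) /\
    density (positions x xN t) i <= rho_theta ;
  sol_free : forall i,
    let xi := fun t => x t ord0 i in
    let rho := fun t => density (positions x xN t) i in
    let U := [set t | t \in `[0, T] /\ rho t < rho_zeta] in
    C2_on T U xi /\
    forall t, U t ->
      eps * zeta (rho t) * dot T (dot T xi) t + gamma * dot T xi t
      = theta (rho t) * F (t, xi t) ;
  (* The interior is the one of the topological space [0, T]. *)
  sol_congested : forall i,
    let xi := fun t => x t ord0 i in
    let rho := fun t => density (positions x xN t) i in
    let U := [set t | t \in `[0, T] /\ rho_zeta < rho t <= rho_theta] `|`
      @interior (subspace `[0, T]) [set t | t \in `[0, T] /\ rho t = rho_zeta] in
    C1_on T U xi /\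
    forall t, U t -> gamma * dot T xi t = theta (rho t) * F (t, xi t) ;
  sol_velocity : forall i, ~~ in_Sigma0 rho_zeta rho_theta x0 i ->
    dot T (fun t => x t ord0 i) 0 = v0 i
}.

(* v~_i^0 *)
Definition vtilde (R : realType) (N : nat) (rho_zeta rho_theta : R)
    (x0 : 'I_N.+1 -> R) (v0 : 'I_N -> R) (i : 'I_N) : R :=
  if in_Sigma0 rho_zeta rho_theta x0 i then 0 else v0 i.

(* Under the assumptions of the theorem, the two suprema are over nonempty
   compact sets of values of continuous functions, hence are maxima. *)
Definition velocity_bound (R : realType) (N : nat) (T gamma : R)
    (theta : R -> R) (rho_zeta rho_theta : R) (F : R * R -> R)
    (x0 : 'I_N.+1 -> R) (v0 : 'I_N -> R) (xN : R -> R) (i : 'I_N) : R :=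
  Num.max (vtilde rho_zeta rho_theta x0 v0 i)
    (sup (theta @` `[0, rho_theta]) / gamma *
     sup (F @` (`[0, T] `*` `[x0 ord0, xN T]))).

(* Main.v *)
(* The followers are treated one at a time, from the leader backwards: given the
   trajectory l of the vehicle ahead, x has to solve a x'' + x' = h with
   a = eps zeta(rho) / gamma and h = theta(rho) F / gamma, continuous functions
   of (t, x(t)) that make sense for every gap once the gap l - x is truncated
   from below at 1 / (N rho_theta).  The implicit Euler scheme
   (a_k + tau) v_{k+1} = a_k v_k + tau h_k, x_{k+1} = x_k + tau v_{k+1}, needs no
   regularisation where a degenerates: v_{k+1} is a convex combination of v_k
   and h_k, whence the bounds on the velocity.  A limit of the scheme along a
   nonprincipal ultrafilter exists without extraction of subsequences.  Where
   a > 0 the discrete velocities are locally equi-Lipschitz and the limit is C^2;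
   where a = 0 on an interval, the distance of v_k to the range of h relaxes with
   a total delay of order max a_k, and the limit satisfies x' = h.  Beyond the
   wall l - 1 / (N rho_theta) both a and h vanish, so that the iterates stop
   there and the limit does not cross it.
   Finally, x is monotone and Lipschitz, hence differentiable almost everywhere,
   and its Lipschitz constant bounds its derivative. *)
From HB Require Import structures.
Require Import Defs.
From mathcomp Require Import all_boot all_order all_algebra.
From mathcomp Require Import all_classical all_reals all_analysis.
From mathcomp Require Import ring lra zify.
Set Implicit Arguments.
Unset Strict Implicit.
Unset Printing Implicit Defensive.
Import Order.TTheory GRing.Theory Num.Theory.
Import numFieldNormedType.Exports.
Local Open Scope classical_set_scope.
Local Open Scope ring_scope.

(** * Almost everywhere differentiability of monotone Lipschitz functions *)

Lemma nondecreasing_klipschitz_continuous (R : realType) (f : R -> R) (k : R) :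
  (forall s t, s <= t -> 0 <= f t - f s <= k * (t - s)) -> continuous f.
Proof.
move=> fk t.
have k0 : 0 <= k by have /andP[a b] := fk 0 1 ler01; lra.
apply/cvgrPdist_le => e e0.
near=> s; have sd : `|t - s| <= e / (k + 1).
  by near: s; apply: cvgr_dist_le => //; rewrite divr_gt0// ltr_wpDl.
have : `|f t - f s| <= k * `|t - s|.
  case: (leP s t) => st.
    have /andP[a b] := fk _ _ st.
    by rewrite (ger0_norm a) (@ger0_norm _ (t - s))// subr_ge0.
  have /andP[a b] := fk _ _ (ltW st).
  by rewrite distrC (ger0_norm a) distrC (@ger0_norm _ (s - t))// subr_ge0 ltW.
move=> /le_trans; apply; rewrite ler_pdivlMr ?ltr_wpDl// in sd.
have := normr_ge0 (t - s); nra.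
Unshelve. all: by end_near. Qed.

(** Precomposition with [clamp 0 T] extends a function on [0, T] to the line by its end values,
    which turns continuity within the segment into plain continuity. *)
Definition clamp (R : realType) (lo hi t : R) : R := Num.max lo (Num.min t hi).

Section clamp.
Context {R : realType} (lo hi : R).
Hypothesis lohi : lo <= hi.

Lemma clamp_bnd t : lo <= clamp lo hi t <= hi.
Proof. by rewrite /clamp le_max lexx/= ge_max lohi/= ge_min lexx orbT. Qed.

Lemma clamp_id t : lo <= t <= hi -> clamp lo hi t = t.
Proof. by move=> /andP[lt th]; rewrite /clamp min_l// max_r. Qed.

Lemma clamp_lip s t : s <= t -> 0 <= clamp lo hi t - clamp lo hi s <= t - s.
Proof.
move=> st; rewrite /clamp; have lh := lohi.
case: (leP s hi) => ?; case: (leP t hi) => ?; rewrite ?(max_r lh);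
by case: (leP lo s) => ?; case: (leP lo t) => ?; apply/andP; split; lra.
Qed.

Lemma clamp_continuous : continuous (clamp lo hi).
Proof.
apply: (@nondecreasing_klipschitz_continuous _ _ 1) => s t /clamp_lip.
by rewrite mul1r.
Qed.

End clamp.

Lemma clamp_klipschitz (R : realType) (T k : R) (x : R -> R) : 0 < T ->
  (forall s t, 0 <= s -> s <= t -> t <= T -> 0 <= x t - x s <= k * (t - s)) ->
  forall s t, s <= t ->
    0 <= x (clamp 0 T t) - x (clamp 0 T s) <= k * (t - s).
Proof.
move=> T0 xk s t /(clamp_lip (ltW T0))/andP[c0 cst].
have k0 : 0 <= k.
  by have /andP[/le_trans/[apply]] := xk _ _ (lexx 0) (ltW T0) (lexx T);
    rewrite subr0 pmulr_lge0.
have /andP[s0 _] := clamp_bnd (ltW T0) s.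
have /andP[_ tT] := clamp_bnd (ltW T0) t.
have cc : clamp 0 T s <= clamp 0 T t by rewrite -subr_ge0.
have /andP[-> /= /le_trans] := xk _ _ s0 cc tT; apply.
by rewrite ler_wpM2l.
Qed.

Lemma klipschitz_within_continuous (R : realType) (T k : R) (x : R -> R) :
  0 < T ->
  (forall s t, 0 <= s -> s <= t -> t <= T -> 0 <= x t - x s <= k * (t - s)) ->
  {within `[0, T], continuous x}.
Proof.
move=> T0 xk; have xc : continuous (x \o clamp 0 T).
  exact: (nondecreasing_klipschitz_continuous (clamp_klipschitz T0 xk)).
have := @continuous_subspaceT _ _ `[0, T]%classic _ xc.
apply: subspace_eq_continuous => t.
by rewrite inE/= in_itv/= /from_subspace/= => tT; rewrite clamp_id.
Qed.

Lemma lebesgue_stieltjes_measure_itvoc (R : realType) (f : cumulative R R)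
    (a b : R) :
  a <= b -> lebesgue_stieltjes_measure f `]a, b]%classic = (f b - f a)%:E.
Proof.
move=> ab; rewrite /lebesgue_stieltjes_measure /measure_extension.
by rewrite measurable_mu_extE/= ?wlength_itv_bnd//; exact: is_ocitv.
Qed.

Section cdf.
Context {R : realType}.
Variables (f : cumulativeBounded (0 : R) (1 : R)) (k : R).
Hypothesis fk : forall s t, s <= t -> f t - f s <= k * (t - s).

Let fk0 s t : s <= t -> 0 <= f t - f s <= k * (t - s).
Proof.
by move=> st; rewrite fk// subr_ge0 andbT; exact: cumulative_is_nondecreasing.
Qed.

Let g (x : R) := k * x - f x.

Let gk s t : s <= t -> 0 <= g t - g s <= k * (t - s).
Proof. by move=> /fk0; rewrite /g; lra. Qed.

Let g_nd : nondecreasing g.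
Proof. by move=> s t /gk; lra. Qed.

HB.instance Definition _ := isCumulative.Build R _ R g g_nd
  (right_continuousW (nondecreasing_klipschitz_continuous gk)).

Let k0 : 0 <= k.
Proof. by have /andP[a b] := fk0 ler01; lra. Qed.

(** For k = 0 the function f would be constant, against its distinct limits 0 and 1 at -oo and
    +oo. *)
Let k_gt0 : 0 < k.
Proof.
rewrite lt_neqAle k0 andbT eq_sym; apply/eqP => kE.
have fc : f = cst (f 0) :> (R -> R).
  apply/funext => x /=; case: (leP 0 x) => x0.
  - by have := fk0 x0; rewrite kE; lra.
  - by have := fk0 (ltW x0); rewrite kE; lra.
have h0 := @cumulativeNy _ _ _ f; have h1 := @cumulativey _ _ _ f.
rewrite fc in h0 h1.
have E0 := cvg_unique (@Rhausdorff R) h0 (cvg_cst (f 0)).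
have E1 := cvg_unique (@Rhausdorff R) h1 (cvg_cst (f 0)).
by have := @oner_neq0 R; rewrite E1 -E0 eqxx.
Qed.

Let kV_ge0 : 0 <= k^-1. Proof. by rewrite invr_ge0. Qed.

(* The Stieltjes measures of f and of g = k id - f add up to k lambda. *)
Let muf_dom : lebesgue_stieltjes_measure f `<< @lebesgue_measure R.
Proof.
pose m := mscale (NngNum kV_ge0) (measure_add (lebesgue_stieltjes_measure f)
  (lebesgue_stieltjes_measure g)).
have mE B : m B = ((k^-1)%:E * (lebesgue_stieltjes_measure f B +
    lebesgue_stieltjes_measure g B))%E.
  by rewrite /m /mscale/= -measure_addE.
move=> A nA B mB BA; have lE : forall B, measurable B -> @lebesgue_measure R B =
    mscale (NngNum kV_ge0) (measure_add (lebesgue_stieltjes_measure f)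
      (lebesgue_stieltjes_measure g)) B.
  move=> {A B nA BA mB} A mA.
  apply: lebesgue_stieltjes_measure_unique => // _ [[a b] _ <-] /=.
  rewrite -/m mE.
  have [ab|ba] := leP a b; last first.
    by rewrite set_itv_ge ?bnd_simp -?leNgt ?ltW// !measure0 adde0 mule0.
  rewrite !lebesgue_stieltjes_measure_itvoc// -EFinD -EFinM /g; congr EFin.
  by rewrite /= /g; field; exact: lt0r_neq0.
have := nA B mB BA; rewrite lE// -/m mE => /eqP.
rewrite mule_eq0 eqe invr_eq0 (gt_eqF k_gt0)/= padde_eq0// => /andP[/eqP + _].
exact.
Qed.

(** By absolute continuity and Radon-Nikodym, f - f a is the integral over ]a, x] of an integrable
    density, and such an integral is differentiable at almost every x > a. *)
Lemma ae_derivable_cdf (a : R) :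
  {ae @lebesgue_measure R, forall x, a < x -> derivable (f : R -> R) x 1}.
Proof.
have [w [w0 wfin wint wE]] := radon_nikodym_sigma_finite muf_dom.
pose u x := fine (w x).
have uE : EFin \o u = w by apply/funext => x /=; rewrite fineK.
have uint y : lebesgue_measure.-integrable `]a, y] (EFin \o u).
  by rewrite uE; apply: integrableS wint.
have uloc : locally_integrable [set: R] u.
  by apply: open_integrable_locally; [exact: openT|rewrite uE].
have := @FTC1 _ _ (BRight a) uint uloc.
apply: filterS; first exact: (ae_filter_ringOfSetsType lebesgue_measure).
move=> x /= H; rewrite -[a < x]/((BRight a < BRight x)%O) => /[dup] + /H [+ _].
rewrite bnd_simp => ax.
have fE y : a < y -> f y = \int[lebesgue_measure]_(t in `]a, y]) u t + f a.
  move=> ay; rewrite /Rintegral (_ : (fun x => (u x)%:E) = w)// -wE//.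
  by rewrite [X in fine X](lebesgue_stieltjes_measure_itvoc f (ltW ay))/= subrK.
move=> Hd.
apply: (near_eq_derivable
  (f := fun y => \int[lebesgue_measure]_(t in `]a, y]) u t + f a)).
  by near=> y; rewrite -fE//; near: y; exact: lt_nbhsr.
by apply: derivableD => //; exact: derivable_cst.
Unshelve. all: by end_near. Qed.
End cdf.

Lemma lipschitz_nondecreasing_ae_derivable (R : realType) (T k : R)
    (x : R -> R) :
  0 < T ->
  (forall s t, 0 <= s -> s <= t -> t <= T -> 0 <= x t - x s <= k * (t - s)) ->
  {ae @lebesgue_measure R, forall t, t \in `]0, T[ -> derivable x t 1}.
Proof.
move=> T0 xk.
pose c := clamp 0 T.
have cE s : 0 <= s -> s <= T -> c s = s.
  by move=> s0 sT; rewrite /c clamp_id// s0.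
have c0 s : s <= 0 -> c s = 0.
  by move=> s0; rewrite /c /clamp min_l ?(le_trans s0 (ltW _))// max_l.
have cT s : T <= s -> c s = T.
  by move=> s0; rewrite /c /clamp min_r// max_r// ltW.
(* Adding the identity to x makes the total increase m positive even when x is constant; dividing by
   m then gives limits 0 and 1. *)
pose m := x T - x 0 + T.
have m0 : 0 < m.
  have /andP[+ _] := xk _ _ (lexx 0) (ltW T0) (lexx T); rewrite /m; lra.
pose f (s : R) := (x (c s) - x 0 + c s) / m.
have fk s t : s <= t -> 0 <= f t - f s <= (k + 1) / m * (t - s).
  move=> st; have /andP[c_ge c_le] := clamp_lip (ltW T0) st.
  have /andP[x_ge x_le] := clamp_klipschitz T0 xk st.
  have -> : f t - f s = ((x (c t) - x (c s)) + (c t - c s)) / m.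
    by rewrite /f; field; rewrite gt_eqF.
  apply/andP; split; first by rewrite divr_ge0 ?(ltW m0)// addr_ge0.
  by rewrite (mulrAC _ m^-1) ler_pM2r ?invr_gt0// mulrDl mul1r lerD.
have fnd : nondecreasing f by move=> s t /fk/andP[+ _]; rewrite subr_ge0.
have frc := right_continuousW (nondecreasing_klipschitz_continuous fk).
have f0 : f @ -oo --> (0 : R).
  apply: cvg_near_cst; near=> s.
  by rewrite /f c0 ?subrr ?add0r ?mul0r//; near: s; exact: nbhs_ninfty_le.
have f1 : f @ +oo --> (1 : R).
  apply: cvg_near_cst; near=> s.
  by rewrite /f cT ?divff ?gt_eqF//; near: s; exact: nbhs_pinfty_ge.
pose F : cumulativeBounded (0 : R) (1 : R) :=
  HB.pack f (isCumulative.Build R _ R f fnd frc)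
    (isCumulativeBounded.Build R 0 1 f f0 f1).
have := @ae_derivable_cdf _ F ((k + 1) / m) (fun s t st => (andP (fk s t st)).2) 0.
apply: filterS; first exact: (ae_filter_ringOfSetsType lebesgue_measure).
move=> t /= + /[!in_itv]/= /andP[t0 tT] => /(_ t0) Ft.
(* Inside ]0, T[ the clamp is inert and x is recovered from F by this affine formula. *)
have : derivable (fun s => m * F s - s + x 0) t 1.
  apply: derivableD; last exact: derivable_cst.
  apply: derivableB; last exact: derivable_id.
  by apply: derivableM => //; exact: derivable_cst.
apply: near_eq_derivable.
near=> s; rewrite /= /f.
have s0 : 0 <= s by rewrite ltW//; near: s; exact: lt_nbhsr.
have sT : s <= T by rewrite ltW//; near: s; exact: lt_nbhsl.
by rewrite cE//; field; rewrite gt_eqF.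
Unshelve. all: by end_near. Qed.

(** * The degenerate second order equation *)

(** The image of an ultrafilter lives on a compact segment, so it has a cluster point; containing
    each set or its complement, it converges there. *)
Lemma ultra_bounded_cvg (R : realType) (I : Type) (U : set_system I)
    (u : I -> R) (a b : R) :
  UltraFilter U -> (forall i, a <= u i <= b) -> exists l : R, u @ U --> l.
Proof.
move=> UU uab; have UP := @ultra_proper _ _ UU.
have [|l [_ lU]] := @segment_compact R a b (fmap u U) (fmap_proper_filter u UP).
  by rewrite /fmap/=; apply: filterE => i /=; rewrite in_itv/= uab.
exists l => B lB.
have [//|nUB] := in_ultra_setVsetC (u @^-1` B) UU.
by have [? []] := lU (~` B) B nUB lB.
Qed.

Lemma cvg_le_near (R : realType) (I : Type) (F : set_system I)
    {FF : ProperFilter F} (f : I -> R) (l c : R) :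
  f @ F --> l -> (forall e, 0 < e -> \forall i \near F, f i <= c + e) -> l <= c.
Proof.
move=> fl fc; apply/ler_addgt0Pr => e e0.
have e2 : 0 < e / 2 by rewrite divr_gt0.
near F => i.
have : f i <= c + e / 2 by near: i; exact: fc.
have : `|l - f i| <= e / 2 by near: i; move/cvgrPdist_le : fl; exact.
by rewrite ler_norml; lra.
Unshelve. all: by end_near. Qed.

(** The potential [b] absorbs errors that are not proportional to the step: it is zero for the
    Lipschitz estimates and a multiple of the velocity excess in [congested]. *)
Lemma telescope_le (R : realDomainType) (w b : nat -> R) (c : R) (i j : nat) :
  (i <= j)%N ->
  (forall k, (i <= k < j)%N -> `|w k.+1 - w k| <= c + (b k - b k.+1)) ->
  `|w j - w i| <= c * (j%:R - i%:R) + (b i - b j).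
Proof.
move=> /subnK <-; elim: (j - i)%N => [|m IH] H.
  by rewrite add0n !subrr normr0 mulr0 addr0.
rewrite addSn in H *.
have {IH}IHm := IH (fun k kP => H k (ltac:(lia))).
have {}H := H (m + i)%N (ltac:(lia)).
have := ler_normD (w (m + i).+1 - w (m + i)%N) (w (m + i)%N - w i).
rewrite addrA subrK -natr1; lra.
Qed.

(* One-sided at t = 0. *)
Definition has_deriv (R : realType) (f : R -> R) (t l : R) :=
  forall e, 0 < e -> exists2 d, 0 < d & forall s, 0 <= s -> `|s - t| <= d ->
    `|f s - f t - l * (s - t)| <= e * `|s - t|.

(* [a x'' + x' = h] where [a > 0] and [x' = h], in integrated form, where
   [a = 0]. *)
Record degenerate_solution (R : realType) (a h : R * R -> R) (x0 v0 V : R)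
    (x v : R -> R) : Prop := DegenerateSolution {
  ds_pos0 : x 0 = x0 ;
  ds_vel0 : v 0 = v0 ;
  ds_lip : forall s t, 0 <= s -> s <= t -> 0 <= x t - x s <= V * (t - s) ;
  ds_free : forall t, 0 <= t -> 0 < a (t, x t) ->
    has_deriv x t (v t) /\
    has_deriv v t ((h (t, x t) - v t) / a (t, x t)) ;
  ds_barrier : forall b : R -> R, {in `[0, +oo[ &, {homo b : s t / s <= t}} ->
    (forall t y, 0 <= t -> b t <= y -> a (t, y) = 0 /\ h (t, y) = 0) ->
    x0 <= b 0 -> forall t, 0 <= t -> x t <= b t ;
  ds_congested : forall s t g c, 0 <= s -> s <= t -> 0 <= c ->
    (forall r, s <= r <= t -> a (r, x r) = 0 /\ `|h (r, x r) - g| <= c) ->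
    `|x t - x s - g * (t - s)| <= c * (t - s) }.

(** * The implicit Euler scheme *)

Section euler_scheme.
Context {R : realType}.
Variables (a h : R * R -> R) (x0 v0 M : R).
Hypotheses (ca : continuous a) (ch : continuous h).
Hypotheses (a_ge0 : forall p, 0 <= a p) (h_bnd : forall p, 0 <= h p <= M).
Hypothesis v0_ge0 : 0 <= v0.

Let V := Num.max v0 M.

Let tau (n : nat) : R := n.+1%:R^-1.

Let tau_gt0 n : 0 < tau n. Proof. by rewrite invr_gt0. Qed.

Let node n k : R := k%:R * tau n.

(** The scheme is implicit in the velocity only: [a] and [h] are frozen at the current node and
    position. Each step is thus an explicit formula, and its denominator is at least tau > 0 even
    where [a] vanishes. *)
Let step n k (p : R * R) : R * R :=
  let A := a (node n k, p.1) in
  let v := (A * p.2 + tau n * h (node n k, p.1)) / (A + tau n) in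
  (p.1 + tau n * v, v).

Let euler n k : R * R := iteri k (step n) (x0, v0).
Let X n k := (euler n k).1.
Let W n k := (euler n k).2.
Let A n k := a (node n k, X n k).
Let H n k := h (node n k, X n k).

Let At_gt0 n k : 0 < A n k + tau n.
Proof. by rewrite ltr_wpDl// a_ge0. Qed.

Let XS n k : X n k.+1 = X n k + tau n * W n k.+1.
Proof. by []. Qed.

(** The velocity update cleared of its denominator, a discrete form of a v' = h - v. *)
Let WS n k : (A n k + tau n) * (W n k.+1 - W n k) = tau n * (H n k - W n k).
Proof.
have -> : W n k.+1 = (A n k * W n k + tau n * H n k) / (A n k + tau n) by [].
by field; rewrite gt_eqF.
Qed.

Let W_bnd n k : 0 <= W n k <= V.
Proof.
elim: k => [|k /andP[w0 wV]]; first by rewrite v0_ge0/= le_max lexx.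
have -> : W n k.+1 = (A n k * W n k + tau n * H n k) / (A n k + tau n) by [].
have A0 : 0 <= A n k by exact: a_ge0.
have /andP[H0 HM] : 0 <= H n k <= M by exact: h_bnd.
have HV : H n k <= V by rewrite (le_trans HM)// le_max lexx orbT.
have t0 := tau_gt0 n.
apply/andP; split; first by rewrite divr_ge0 ?addr_ge0 ?mulr_ge0// ltW.
rewrite ler_pdivrMr// mulrDr [V * _]mulrC [V * tau n]mulrC.
by rewrite lerD// ler_wpM2l// ltW.
Qed.

Let V_ge0 : 0 <= V.
Proof. by rewrite le_max v0_ge0. Qed.

Let X_mono n i j : (i <= j)%N ->
  0 <= X n j - X n i <= V * (node n j - node n i).
Proof.
move=> /subnK <-; elim: (j - i)%N => [|m /andP[IH0 IHV]].
  by rewrite add0n !subrr mulr0 lexx.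
rewrite addSn XS; have /andP[w0 wV] := W_bnd n (m + i).+1.
have t0 := tau_gt0 n.
have -> : node n (m + i).+1 = node n (m + i) + tau n.
  by rewrite /node -natr1 mulrDl mul1r.
have : tau n * W n (m + i).+1 <= tau n * V by rewrite ler_wpM2l// ltW.
have : 0 <= tau n * W n (m + i).+1 by rewrite mulr_ge0// ltW.
by move=> ? ?; apply/andP; split; lra.
Qed.

Let X_lip n i j : `|X n j - X n i| <= V * `|node n j - node n i|.
Proof.
wlog ij : i j / (i <= j)%N => [th|].
  by have [/th//|/ltnW/th] := leqP i j; rewrite distrC (distrC (node n i)).
have /andP[x0_ xV] := X_mono n ij.
rewrite (ger0_norm x0_) ger0_norm// subr_ge0 /node ler_pM2r//.
by rewrite ler_nat.
Qed.

(** For t >= 0 this is the last node not after t, so that [X n (idx n t)] reads the discrete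
    trajectory as a step function of time. *)
Let idx n (t : R) : nat := Num.trunc (t * n.+1%:R).

Let idxP n t : 0 <= t -> node n (idx n t) <= t < node n (idx n t) + tau n.
Proof.
move=> t0; have := @Num.Theory.truncn_itv R (t * n.+1%:R).
rewrite mulr_ge0// => /(_ erefl)/andP[l r].
rewrite /node /tau ler_pdivrMr// l/= -{2}[_^-1]mul1r -mulrDl natr1.
by rewrite ltr_pdivlMr.
Qed.

Let idx0 n : idx n 0 = 0%N.
Proof. by rewrite /idx mul0r truncn0. Qed.

Let le_idx n s t : s <= t -> (idx n s <= idx n t)%N.
Proof. by move=> st; apply: le_truncn; rewrite ler_wpM2r. Qed.

(** * Limit of the scheme along an ultrafilter *)

Section limit.
Variables (U : set_system nat) (x v : R -> R).
Hypotheses (UU : UltraFilter U) (Uoo : \oo `<=` U).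
Hypothesis xl : forall t, 0 <= t -> (fun n => X n (idx n t)) @ U --> x t.
Hypothesis vl : forall t, 0 <= t -> (fun n => W n (idx n t)) @ U --> v t.

Let UP : ProperFilter U := @ultra_proper _ _ UU.

Let tau_le e : 0 < e -> \forall n \near U, tau n <= e.
Proof.
move=> e0; apply: Uoo; have := near_infty_natSinv_lt (PosNum e0).
by apply: filterS => n /ltW.
Qed.

Let x_init : x 0 = x0.
Proof.
apply: (cvg_unique (@Rhausdorff R) (xl (lexx 0))).
rewrite (_ : (fun n => X n (idx n 0)) = cst x0); first exact: cvg_cst.
by apply/funext => n; rewrite idx0.
Qed.

Let v_init : v 0 = v0.
Proof.
apply: (cvg_unique (@Rhausdorff R) (vl (lexx 0))).
rewrite (_ : (fun n => W n (idx n 0)) = cst v0); first exact: cvg_cst.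
by apply/funext => n; rewrite idx0.
Qed.

Let idx_diff n s t : 0 <= s -> s <= t ->
  `|(node n (idx n t) - node n (idx n s)) - (t - s)| <= tau n.
Proof.
move=> s0 st; have /andP[] := idxP n s0; have /andP[] := idxP n (le_trans s0 st).
by move=> *; rewrite ler_norml; apply/andP; split; lra.
Qed.

Let x_lip s t : 0 <= s -> s <= t -> 0 <= x t - x s <= V * (t - s).
Proof.
move=> s0 st; have t0 := le_trans s0 st.
have cX : (fun n => X n (idx n t) - X n (idx n s)) @ U --> x t - x s.
  by apply: cvgB; exact: xl.
apply/andP; split.
  rewrite -oppr_le0; apply: (cvg_le_near (cvgN cX)) => e e0.
  apply: filterE => n; rewrite fctE /=; have /andP[? _] := X_mono n (le_idx n st); lra.
apply: (cvg_le_near cX) => e e0; near=> n.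
have /andP[_ /le_trans] := X_mono n (le_idx n st); apply.
have tn : tau n <= e / (V + 1).
  by near: n; apply: tau_le; rewrite divr_gt0// ltr_wpDl.
rewrite ler_pdivlMr ?ltr_wpDl// in tn.
have /ler_normlP[_ d] := idx_diff n s0 st.
have : V * (node n (idx n t) - node n (idx n s)) <= V * (t - s + tau n).
  by rewrite ler_wpM2l//; lra.
have := tau_gt0 n; nra.
Unshelve. all: by end_near. Qed.

(** Convergence at the single time t0 suffices: the discrete trajectories are V-Lipschitz uniformly
    in n, so on a whole window of nodes they stay near (t0, x t0). *)
Let near_x t0 Q : 0 <= t0 -> nbhs (t0, x t0) Q -> exists2 d, 0 < d &
  \forall n \near U, forall k, `|node n k - t0| <= d -> Q (node n k, X n k).
Proof.
move=> t00 /nbhs_ballP[r /= r0 rQ].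
have V1 : 0 < V + 1 by rewrite ltr_wpDl.
(* The index of t0 and k are at most 2 d apart in time, hence 2 d V <= r / 2 in space; convergence
   at t0 costs another r / 4. *)
have [d d0 dV] : exists2 d, 0 < d & d * (4 * (V + 1)) = r.
  exists (r / (4 * (V + 1))); first by rewrite divr_gt0// mulr_gt0.
  by rewrite divfK// gt_eqF// mulr_gt0.
exists d => //; near=> n => k kt.
have tn : tau n <= d by near: n; exact: tau_le.
have xn : `|x t0 - X n (idx n t0)| <= r / 4.
  by near: n; move/cvgrPdist_le: (xl t00); apply; rewrite divr_gt0.
have /andP[i1 i2] := idxP n t00.
have XX := X_lip n (idx n t0) k.
have N : `|node n k - node n (idx n t0)| <= d + d.
  move: kt; rewrite !ler_norml => /andP[? ?]; apply/andP; split; lra.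
have dV0 : 0 <= d * V by rewrite mulr_ge0// ltW.
have VN : V * `|node n k - node n (idx n t0)| <= V * (d + d) by rewrite ler_wpM2l.
apply: rQ; split => /=; rewrite /ball/=.
  by rewrite distrC (le_lt_trans kt)//; nra.
rewrite (le_lt_trans (ler_distD (X n (idx n t0)) _ _))//.
by rewrite (distrC (X n (idx n t0))); have XV := le_trans XX VN; lra.
Unshelve. all: by end_near. Qed.

(** Compactness of [s, t] makes the windows of [near_x] uniform: a single eventual set of n serves
    all nodes. *)
Let near_nodes s t Q : 0 <= s -> s <= t ->
  (forall r, s <= r <= t -> nbhs (r, x r) Q) ->
  \forall n \near U, forall k, (idx n s <= k <= idx n t)%N ->
    Q (node n k, X n k).
Proof.
move=> s0 st sQ.
(* The tolerance [tau n] takes care of the node [idx n s], which may lie before s. *)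
pose P n r := forall k, `|node n k - r| <= tau n -> Q (node n k, X n k).
have : \forall n \near U, `[s, t] `<=` P n.
  have /compact_near_coveringP := @segment_compact R s t; apply => r.
  rewrite /= in_itv/= => /[dup] /andP[sr rt] /sQ/near_x[|d d0 nQ].
    exact: le_trans sr.
  have d2 : 0 < d / 2 by rewrite divr_gt0.
  near=> r' n => k kr'.
  have tn : tau n <= d / 2 by near: n; exact: tau_le.
  have rr' : `|r - r'| <= d / 2 by near: r'; apply: cvgr_dist_le.
  have Qn : forall k, `|node n k - r| <= d -> Q (node n k, X n k) by near: n.
  apply: Qn; rewrite (le_trans (ler_distD r' _ _))// (distrC r'); lra.
apply: filterS => n stP k /andP[sk kt].
have sI := idxP n s0; have tI := idxP n (le_trans s0 st).
have nle i j : (i <= j)%N -> node n i <= node n j.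
  by move=> ij; rewrite /node ler_pM2r// ler_nat.
have /andP[k1 k2] : node n (idx n s) <= node n k <= node n (idx n t).
  by rewrite !nle.
move: sI tI => /andP[s1 s2] /andP[t1 t2].
have [sk'|ks'] := leP s (node n k).
  apply: (stP (node n k)); last by rewrite subrr normr0 ltW.
  by rewrite /= in_itv/= sk'/=; lra.
apply: (stP s); first by rewrite /= in_itv/= lexx.
by rewrite ler_norml; apply/andP; split; lra.
Unshelve. all: by end_near. Qed.

(** Common passage to the limit for positions and velocities. The term [e * b] is independent of the
    time elapsed and leaves room for the boundary term of a telescoped sum. *)
Let limit_increment (u : nat -> nat -> R) (l : R -> R) s t g c b :
  0 <= s -> s <= t -> 0 <= c -> 0 <= b ->
  (forall t, 0 <= t -> (fun n => u n (idx n t)) @ U --> l t) ->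
  (forall e, 0 < e -> \forall n \near U,
     `|u n (idx n t) - u n (idx n s) - g * (node n (idx n t) - node n (idx n s))|
     <= (c + e) * (node n (idx n t) - node n (idx n s)) + e * b) ->
  `|l t - l s - g * (t - s)| <= c * (t - s).
Proof.
move=> s0 st c0 b0 ul uH; have t0 := le_trans s0 st.
have cu : (fun n => `|u n (idx n t) - u n (idx n s) - g * (t - s)|) @ U -->
    `|l t - l s - g * (t - s)|.
  by apply: cvg_norm; apply: cvgB; [apply: cvgB; exact: ul|exact: cvg_cst].
apply: (cvg_le_near cu) => e' e'0.
(* Since the node distance is at most t - s + e, the total error is e (c + (t - s) + e + b + |g|),
   which is at most e K as soon as e <= 1. *)
pose K := c + (t - s) + 1 + b + `|g|.
have K0 : 0 < K by rewrite /K; have := normr_ge0 g; lra.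
have [e e0 [e1 eK]] : exists2 e, 0 < e & e <= 1 /\ e * K <= e'.
  exists (Num.min 1 (e' / K)); first by rewrite lt_min ltr01 divr_gt0.
  by split; rewrite ?ge_min ?lexx// -ler_pdivlMr// ge_min lexx orbT.
near=> n.
have tn : tau n <= e by near: n; exact: tau_le.
have un : `|u n (idx n t) - u n (idx n s) -
      g * (node n (idx n t) - node n (idx n s))|
     <= (c + e) * (node n (idx n t) - node n (idx n s)) + e * b.
  by near: n; exact: uH.
have nd := idx_diff n s0 st.
set N := node n (idx n t) - _ in un nd.
have gN : `|g * (N - (t - s))| <= `|g| * e.
  by rewrite normrM ler_wpM2l// (le_trans nd).
have -> : u n (idx n t) - u n (idx n s) - g * (t - s) =
  u n (idx n t) - u n (idx n s) - g * N + g * (N - (t - s)) by ring.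
rewrite (le_trans (ler_normD _ _))// (le_trans (lerD un gN))//.
have cN : (c + e) * N <= (c + e) * (t - s + e).
  by rewrite ler_wpM2l ?addr_ge0 ?(ltW e0)//; move/ler_normlP: nd => [_ ?]; lra.
have ee : e * e <= e * 1 by rewrite ler_wpM2l// ltW.
rewrite /K in eK; lra.
Unshelve. all: by end_near. Qed.

(** One-step estimates that are uniform on a window of nodes telescope to increments between any two
    times of the half window, and these pass to the limit. Halving leaves room for the last node
    before each time. *)
Let limit_deriv (u : nat -> nat -> R) (l : R -> R) t0 g : 0 <= t0 ->
  (forall t, 0 <= t -> (fun n => u n (idx n t)) @ U --> l t) ->
  (forall e, 0 < e -> exists2 d, 0 < d & \forall n \near U,
     forall k, `|node n k - t0| <= d ->
     `|u n k.+1 - u n k - g * tau n| <= e * tau n) ->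
  has_deriv l t0 g.
Proof.
move=> t00 ul uH e e0; have [d d0 nd] := uH e e0.
have d2 : 0 < d / 2 by rewrite divr_gt0.
have main r r' : 0 <= r -> r <= r' -> `|r - t0| <= d / 2 -> `|r' - t0| <= d / 2 ->
    `|l r' - l r - g * (r' - r)| <= e * (r' - r).
  move=> r0 rr' rd rd'; apply: (limit_increment r0 rr' (ltW e0) (lexx 0) ul).
  move=> e1 e10; near=> n.
  have tn : tau n <= d / 2 by near: n; exact: tau_le.
  have un : forall k, `|node n k - t0| <= d ->
      `|u n k.+1 - u n k - g * tau n| <= e * tau n by near: n.
  have nle i j : (i <= j)%N -> node n i <= node n j.
    by move=> ij; rewrite /node ler_pM2r// ler_nat.
  have ij := le_idx n rr'.
  have := @telescope_le R (fun k => u n k - g * node n k) (fun=> 0)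
    (e * tau n) _ _ ij; rewrite subrr => /(_ _)/wrap[].
    move=> k /andP[ik /ltnW kj].
    have -> : u n k.+1 - g * node n k.+1 - (u n k - g * node n k) =
              u n k.+1 - u n k - g * tau n by rewrite /node -natr1; ring.
    rewrite addr0; apply: un.
    have /andP[i1 i2] := idxP n r0; have /andP[j1 j2] := idxP n (le_trans r0 rr').
    have := nle _ _ ik; have := nle _ _ kj; move: rd rd'.
    by rewrite !ler_norml => /andP[? ?] /andP[? ?] ? ?; apply/andP; split; lra.
  have -> : u n (idx n r') - g * node n (idx n r') - (u n (idx n r) -
      g * node n (idx n r)) = u n (idx n r') - u n (idx n r) -
      g * (node n (idx n r') - node n (idx n r)) by ring.
  move=> /le_trans; apply.
  rewrite mulr0 !addr0 -mulrA [tau n * _]mulrC mulrBl -/(node n _) -/(node n _).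
  by rewrite ler_wpM2r ?subr_ge0 ?nle// lerDl ltW.
exists (d / 2) => // s s0 sd; have [st|ts] := leP s t0.
  have := main s t0 s0 st sd; rewrite subrr normr0 => /(_ (ltW d2)).
  rewrite (distrC s) (@ger0_norm _ (t0 - s)) ?subr_ge0// => /(le_trans _); apply.
  by rewrite -normrN; rewrite le_eqVlt; apply/orP; left; apply/eqP; congr `|_|; ring.
have := main t0 s t00 (ltW ts); rewrite subrr normr0 => /(_ (ltW d2) sd).
by rewrite (@ger0_norm _ (s - t0)) ?subr_ge0// ltW.
Unshelve. all: by end_near. Qed.

Let nbhs_comp (f : R * R -> R) p e : continuous f -> 0 < e ->
  nbhs p [set q | `|f q - f p| <= e].
Proof.
move=> cf e0; have /cvgrPdist_le/(_ _ e0) := cf p.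
by apply: filterS => q; rewrite /= distrC.
Qed.

(** Where a > 0, the update formula makes the discrete velocities Lipschitz uniformly in n, so that
    their convergence at t0 alone controls them on a window of nodes, and at the next index too. *)
Let near_free t0 e : 0 <= t0 -> 0 < a (t0, x t0) -> 0 < e ->
  exists2 d, 0 < d & \forall n \near U, forall k, `|node n k - t0| <= d ->
    [/\ a (t0, x t0) / 2 <= A n k, `|A n k - a (t0, x t0)| <= e,
      `|H n k - h (t0, x t0)| <= e, `|W n k - v t0| <= e &
      `|W n k.+1 - v t0| <= e].
Proof.
set a0 := a _ => t00 a00 e0.
have e1_0 : 0 < Num.min e (a0 / 2) by rewrite lt_min e0 divr_gt0.
have [d d0 nd] := near_x t00 (filterI (nbhs_comp (t0, x t0) ca e1_0)
  (nbhs_comp (t0, x t0) ch e0)).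
have V1 : 0 < V + 1 by rewrite ltr_wpDl.
(* The velocity increment is tau (H - W) / (A + tau), with |H - W| <= V and A >= a0 / 2 on the
   window. *)
pose L := V / (a0 / 2).
have L0 : 0 <= L by rewrite divr_ge0// ltW// divr_gt0.
(* Two nodes within d' + tau <= 2 d' of t0 are at most 4 d' apart, so their velocities differ by at
   most 4 L d' <= e / 2. *)
pose d' := Num.min (d / 2) (e / (8 * (L + 1))).
have L1 : 0 < L + 1 by rewrite ltr_wpDl.
have d'0 : 0 < d' by rewrite lt_min !divr_gt0// mulr_gt0.
have d'd : d' <= d / 2 by rewrite ge_min lexx.
have d'e : d' * (8 * (L + 1)) <= e.
  by rewrite -ler_pdivlMr ?mulr_gt0// ge_min lexx orbT.
exists d' => //; near=> n => k kt.
have tn : tau n <= d' by near: n; exact: tau_le.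
have vn : `|v t0 - W n (idx n t0)| <= e / 2.
  by near: n; move/cvgrPdist_le: (vl t00); apply; rewrite divr_gt0.
have dn : forall k, `|node n k - t0| <= d ->
    `|A n k - a0| <= Num.min e (a0 / 2) /\ `|H n k - h (t0, x t0)| <= e.
  by near: n; apply: filterS nd => n nd k /nd[].
have {}dn k' : `|node n k' - t0| <= d -> [/\ a0 / 2 <= A n k',
    `|A n k' - a0| <= e & `|H n k' - h (t0, x t0)| <= e].
  move=> /dn[]; rewrite le_min => /andP[ae aa he]; split=> //.
  by move/ler_normlP : aa => [? ?]; lra.
have nle i j : (i <= j)%N -> node n i <= node n j.
  by move=> ij; rewrite /node ler_pM2r// ler_nat.
have Wstep k' : `|node n k' - t0| <= d -> `|W n k'.+1 - W n k'| <= L * tau n.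
  move=> /dn[ak _ _].
  have : (A n k' + tau n) * `|W n k'.+1 - W n k'| <= tau n * V.
    rewrite -(@ger0_norm _ (A n k' + tau n)) ?(ltW (At_gt0 _ _))//.
    rewrite -normrM WS normrM (@gtr0_norm _ (tau n))// ler_pM2l//.
    have /andP[? ?] := W_bnd n k'; have /andP[? ?] : 0 <= H n k' <= M by exact: h_bnd.
    have : M <= V by rewrite le_max lexx orbT.
    by rewrite ler_norml => ?; apply/andP; split; lra.
  have : a0 / 2 * `|W n k'.+1 - W n k'| <= (A n k' + tau n) * `|W n k'.+1 - W n k'|.
    by rewrite ler_wpM2r//; have := tau_gt0 n; lra.
  move=> /le_trans/[apply]; rewrite mulrC -ler_pdivlMr ?divr_gt0//.
  by move=> /le_trans; apply; rewrite le_eqVlt /L; apply/orP; left; apply/eqP; ring.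
have Wlip i j : (i <= j)%N -> `|node n i - t0| <= d -> `|node n j - t0| <= d ->
    `|W n j - W n i| <= L * (node n j - node n i).
  move=> ij id jd; have := @telescope_le R (W n) (fun=> 0) (L * tau n) _ _ ij.
  rewrite subrr => /(_ _)/wrap[].
    move=> k' /andP[/nle ik /ltnW/nle kj]; rewrite addr0; apply: Wstep.
    by move: id jd; rewrite !ler_norml => /andP[? ?] /andP[? ?]; apply/andP; split; lra.
  by rewrite addr0 -mulrA [tau n * _]mulrC mulrBl.
have Wlip2 i j : `|node n i - t0| <= d' + tau n -> `|node n j - t0| <= d' + tau n ->
    `|W n j - W n i| <= L * (4 * d').
  wlog ij : i j / (i <= j)%N => [th|] id jd.
    by have [/th/(_ id jd)//|/ltnW/th/(_ jd id)] := leqP i j; rewrite distrC.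
  have := Wlip i j ij; rewrite (le_trans id) ?(le_trans jd); [|lra..].
  move=> /(_ erefl erefl)/le_trans; apply; rewrite ler_wpM2l//.
  by move: id jd; rewrite !ler_norml => /andP[? ?] /andP[? ?]; lra.
have id : `|node n (idx n t0) - t0| <= d' + tau n.
  have /andP[? ?] := idxP n t00.
  by rewrite ler_norml; apply/andP; split; lra.
have kd : `|node n k - t0| <= d' + tau n by rewrite (le_trans kt)// lerDl ltW.
have kSd : `|node n k.+1 - t0| <= d' + tau n.
  have -> : node n k.+1 - t0 = node n k - t0 + tau n by rewrite /node -natr1; ring.
  by rewrite (le_trans (ler_normD _ _))// (gtr0_norm (tau_gt0 n)) lerD2r.
have [] := dn k; first by rewrite (le_trans kt)//; lra.
have Ld : L * (4 * d') <= e / 2 by lra.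
move=> *; split => //.
  rewrite (le_trans (ler_distD (W n (idx n t0)) _ _))//.
  by have := Wlip2 _ _ id kd; rewrite distrC in vn; lra.
rewrite (le_trans (ler_distD (W n (idx n t0)) _ _))//.
by have := Wlip2 _ _ id kSd; rewrite distrC in vn; lra.
Unshelve. all: by end_near. Qed.

Let free_deriv_x t0 : 0 <= t0 -> 0 < a (t0, x t0) -> has_deriv x t0 (v t0).
Proof.
move=> t00 a00; apply: (limit_deriv t00 xl) => e e0.
have [d d0 nd] := near_free t00 a00 e0; exists d => //.
apply: filterS nd => n nd k /nd[_ _ _ _ Wk].
have -> : X n k.+1 - X n k - v t0 * tau n = (W n k.+1 - v t0) * tau n.
  by rewrite XS; ring.
by rewrite normrM (gtr0_norm (tau_gt0 n)) ler_pM2r.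
Qed.

Let free_deriv_v t0 : 0 <= t0 -> 0 < a (t0, x t0) ->
  has_deriv v t0 ((h (t0, x t0) - v t0) / a (t0, x t0)).
Proof.
move=> t00 a00; apply: (limit_deriv t00 vl) => e e0.
set a0 := a _ in a00 *; set h0 := h _; set g := _ / _.
have ga : g * a0 = h0 - v t0 by rewrite divfK// gt_eqF.
have g1 : 0 < 1 + `|g| by rewrite ltr_pwDl.
(* The numerator below is at most 2 (1 + |g|) e1 tau and the denominator at least a0 / 2; this e1
   makes the quotient e tau. *)
have [e1 e10 e1E] : exists2 e1, 0 < e1 & 4 * (1 + `|g|) * e1 = e * a0.
  exists (e * a0 / (4 * (1 + `|g|))); first by rewrite !divr_gt0 ?mulr_gt0.
  by rewrite mulrC divfK// gt_eqF// mulr_gt0.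
have [d d0 nd] := near_free t00 a00 e10; exists d => //; near=> n => k kt.
have tn : tau n <= e1 by near: n; exact: tau_le.
have [aA Aa Hh Wv _] : [/\ a0 / 2 <= A n k, `|A n k - a0| <= e1,
    `|H n k - h0| <= e1, `|W n k - v t0| <= e1 & `|W n k.+1 - v t0| <= e1].
  by move: k kt; near: n.
have t0n := tau_gt0 n; have At0 := At_gt0 n k.
(* The relation g a0 = h0 - v t0 cancels the main terms and leaves only deviations of order e1. *)
have E : (A n k + tau n) * (W n k.+1 - W n k - g * tau n) =
  tau n * ((H n k - h0) - (W n k - v t0) - g * (A n k - a0) - g * tau n).
  by rewrite mulrBr WS; have -> : h0 = g * a0 + v t0 by [rewrite ga subrK]; ring.
have : (A n k + tau n) * `|W n k.+1 - W n k - g * tau n| <=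
    tau n * (2 * e1 + `|g| * (2 * e1)).
  rewrite -[leLHS]ger0_norm ?mulr_ge0 ?(ltW At0)// normrM normr_id -normrM.
  rewrite E normrM (gtr0_norm t0n) ler_pM2l//.
  have gA : `|g * (A n k - a0)| <= `|g| * e1 by rewrite normrM ler_wpM2l.
  have gt : `|g * tau n| <= `|g| * e1.
    by rewrite normrM ler_wpM2l// gtr0_norm.
  rewrite (le_trans (ler_normB _ _))// (le_trans (lerD (ler_normB _ _) gt))//.
  rewrite (le_trans (lerD (lerD (ler_normB _ _) gA) (lexx _)))//; lra.
have : a0 / 2 * `|W n k.+1 - W n k - g * tau n| <=
    (A n k + tau n) * `|W n k.+1 - W n k - g * tau n|.
  by rewrite ler_wpM2r//; lra.
move=> /le_trans/[apply].
have -> : tau n * (2 * e1 + `|g| * (2 * e1)) = a0 / 2 * (e * tau n).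
  have -> : tau n * (2 * e1 + `|g| * (2 * e1)) =
    tau n * (4 * (1 + `|g|) * e1) / 2 by field.
  by rewrite e1E; field.
by rewrite ler_pM2l// divr_gt0.
Unshelve. all: by end_near. Qed.

(* b k, the excess of |v_k - g| over c + e, satisfies
   tau b_{k+1} <= a_k (b_k - b_{k+1}) with a_k <= e, so that the sum of the
   tau b_k telescopes to O(e). *)
Let congested s t g c : 0 <= s -> s <= t -> 0 <= c ->
  (forall r, s <= r <= t -> a (r, x r) = 0 /\ `|h (r, x r) - g| <= c) ->
  `|x t - x s - g * (t - s)| <= c * (t - s).
Proof.
move=> s0 st c0 ah.
have C0 : 0 <= V + `|g| by rewrite addr_ge0.
apply: (limit_increment s0 st c0 C0 xl) => e e0.
have : \forall n \near U, forall k, (idx n s <= k <= idx n t)%N ->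
    [set q | a q <= e /\ `|h q - g| <= c + e] (node n k, X n k).
  apply: (near_nodes s0 st) => r /ah[ar hr].
  apply: filterS (filterI (nbhs_comp (r, x r) ca e0)
    (nbhs_comp (r, x r) ch e0)) => q /= []; rewrite ar subr0 => aq hq; split.
    by rewrite (le_trans _ aq)// ler_norm.
  by rewrite (le_trans (ler_distD (h (r, x r)) _ _))//; lra.
apply: filterS => n nst.
have t0 := tau_gt0 n; set c1 := c + e in nst *.
have c10 : 0 <= c1 by rewrite addr_ge0// ltW.
pose b k := Num.max (`|W n k - g| - c1) 0.
have b0 k : 0 <= b k by rewrite le_max lexx orbT.
have bW k : `|W n k - g| <= c1 + b k by rewrite -lerBlDl le_max lexx.
have bC k : b k <= V + `|g|.
  rewrite ge_max C0 andbT; have /andP[? ?] := W_bnd n k.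
  by have := ler_normB (W n k) g; rewrite (@ger0_norm _ (W n k))//; lra.
have bS k : (idx n s <= k <= idx n t)%N -> tau n * b k.+1 <= e * (b k - b k.+1).
  move=> /nst[/= ae hg]; have A0 : 0 <= A n k by exact: a_ge0.
  have bA : (A n k + tau n) * b k.+1 <= A n k * b k.
    rewrite {1}/b; have [_|] := leP (`|W n k.+1 - g| - c1) 0.
      by rewrite mulr0 mulr_ge0.
    move=> _; have E : (A n k + tau n) * (W n k.+1 - g) =
      A n k * (W n k - g) + tau n * (H n k - g) by have ws := WS n k; lra.
    have : (A n k + tau n) * `|W n k.+1 - g| <=
        A n k * `|W n k - g| + tau n * `|H n k - g|.
      rewrite -(@ger0_norm _ (A n k + tau n)) ?(ltW (At_gt0 _ _))// -normrM E.
      by rewrite (le_trans (ler_normD _ _))// !normrM (ger0_norm A0) (gtr0_norm t0).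
    have : A n k * `|W n k - g| <= A n k * (c1 + b k) by rewrite ler_wpM2l.
    have : tau n * `|H n k - g| <= tau n * c1 by rewrite ler_wpM2l// ltW.
    lra.
  (* The excess decreases, which allows replacing [A n k] by its bound e; if [A n k] is zero, [bA]
     forces the new excess to vanish. *)
  have bb : b k.+1 <= b k.
    have : A n k * b k.+1 <= A n k * b k by have := mulr_ge0 (ltW t0) (b0 k.+1); lra.
    have [A1|A1] := ltP 0 (A n k); first by rewrite ler_pM2l.
    move=> _; have AE : A n k = 0 by apply/eqP; rewrite eq_le A1.
    have : tau n * b k.+1 <= 0 by move: bA; rewrite AE add0r mul0r.
    by rewrite pmulr_rle0// => /le_trans; apply.
  have : A n k * (b k - b k.+1) <= e * (b k - b k.+1) by rewrite ler_wpM2r ?subr_ge0.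
  lra.
have ij := le_idx n st.
have := @telescope_le R (fun k => X n k - g * node n k) (fun k => e * b k)
    (c1 * tau n) _ _ ij => /(_ _)/wrap[].
  move=> k /andP[ik /ltnW kj]; have := bS k; rewrite ik kj => /(_ erefl) bk.
  have -> : X n k.+1 - g * node n k.+1 - (X n k - g * node n k) =
            tau n * (W n k.+1 - g) by rewrite XS /node -natr1; ring.
  rewrite normrM (gtr0_norm t0).
  have : tau n * `|W n k.+1 - g| <= tau n * (c1 + b k.+1) by rewrite ler_pM2l.
  lra.
have -> : X n (idx n t) - g * node n (idx n t) - (X n (idx n s) -
    g * node n (idx n s)) = X n (idx n t) - X n (idx n s) -
    g * (node n (idx n t) - node n (idx n s)) by ring.
move=> /le_trans; apply; rewrite /node -mulrBl -mulrA (mulrC (tau n)) lerD2l.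
have : e * b (idx n s) <= e * (V + `|g|) by rewrite ler_pM2l.
by have := mulr_ge0 (ltW e0) (b0 (idx n t)); lra.
Qed.

(* A single Euler step overshoots b by at most V tau, and the iterates do not
   move when they are beyond b. *)
Let barrier (b : R -> R) : {in `[0, +oo[ &, {homo b : s t / s <= t}} ->
  (forall t y, 0 <= t -> b t <= y -> a (t, y) = 0 /\ h (t, y) = 0) ->
  x0 <= b 0 -> forall t, 0 <= t -> x t <= b t.
Proof.
move=> bm b0 x0b.
have node0 n k : 0 <= node n k by rewrite mulr_ge0// ltW.
have Xb n k : X n k <= b (node n k) + V * tau n.
  elim: k => [|k IH].
    by rewrite /node mul0r (le_trans x0b)// lerDl mulr_ge0// ltW.
  have bS : b (node n k) <= b (node n k.+1).
    apply: bm; rewrite ?in_itv/= ?node0//.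
    by rewrite /node ler_pM2r// ler_nat.
  have t0 := tau_gt0 n; rewrite XS; have [bx|xb] := leP (b (node n k)) (X n k).
    have [A0 H0] := b0 _ _ (node0 n k) bx.
    have -> : W n k.+1 = (A n k * W n k + tau n * H n k) / (A n k + tau n) by [].
    by rewrite /A /H A0 H0 !mul0r !mulr0 addr0 mul0r mulr0 addr0; lra.
  have /andP[_ WV] := W_bnd n k.+1.
  by have : tau n * W n k.+1 <= tau n * V; [rewrite ler_pM2l|lra].
move=> t t0; apply: (cvg_le_near (xl t0)) => e e0; near=> n.
have tn : tau n <= e / (V + 1).
  by near: n; apply: tau_le; rewrite divr_gt0// ltr_wpDl.
rewrite ler_pdivlMr ?ltr_wpDl// in tn.
have /andP[nt _] := idxP n t0.
have : b (node n (idx n t)) <= b t by apply: bm; rewrite ?in_itv/= ?node0 ?t0.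
by have := Xb n (idx n t); have := tau_gt0 n; lra.
Unshelve. all: by end_near. Qed.

Lemma limit_degenerate_solution : degenerate_solution a h x0 v0 V x v.
Proof.
split; [exact: x_init|exact: v_init|exact: x_lip| |exact: barrier|
  exact: congested].
by move=> t t0 at0; split; [exact: free_deriv_x|exact: free_deriv_v].
Qed.

End limit.

Theorem degenerate_solution_exists : exists x v : R -> R,
  degenerate_solution a h x0 v0 (Num.max v0 M) x v.
Proof.
have [U [UU Uoo]] := ultraFilterLemma (_ : ProperFilter \oo).
have /choice[x xl] t : exists l : R, 0 <= t ->
    (fun n => X n (idx n t)) @ U --> l.
  have [t0|_] := leP 0 t; last by exists 0.
  have [|l lU] := @ultra_bounded_cvg R _ U (fun n => X n (idx n t)) x0
      (x0 + V * t) UU; last by exists l.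
  move=> n; have /andP[] := X_mono n (leq0n (idx n t)).
  rewrite {1 3}/X/= subr_ge0 => -> /=.
  rewrite lerBlDl => /le_trans; apply; rewrite lerD2l ler_wpM2l//.
  have /andP[+ _] := idxP n t0; rewrite /node mul0r subr0; exact.
have /choice[v vl] t : exists l : R, 0 <= t ->
    (fun n => W n (idx n t)) @ U --> l.
  have [|l lU] := @ultra_bounded_cvg R _ U (fun n => W n (idx n t)) 0 V UU;
    by [|exists l].
by exists x, v; exact: (limit_degenerate_solution UU).
Qed.

End euler_scheme.

(** * Derivatives relative to [0, T] *)

Section derivative_in.
Context {R : realType} (T : R).
Hypothesis T0 : 0 < T.

Lemma within_dnbhs_proper t : 0 <= t <= T ->
  ProperFilter (within `[0, T] t^').
Proof.
move=> /andP[t0 tT]; split; last exact: within_filter.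
move=> /= /nbhs_ballP[e /= e0 /= eP].
have [s [s0 sT st ste]] : exists s, [/\ 0 <= s, s <= T, s != t & `|t - s| < e].
  (* The nearby point is taken towards the more distant end of [0, T], so that a displacement of at
     most T / 2 stays inside. *)
  have [tT2|tT2] := leP t (T / 2).
    exists (t + Num.min (T / 2) (e / 2)).
    have m0 : 0 < Num.min (T / 2) (e / 2) by rewrite lt_min !divr_gt0.
    have mT : Num.min (T / 2) (e / 2) <= T / 2 by rewrite ge_min lexx.
    have me : Num.min (T / 2) (e / 2) <= e / 2 by rewrite ge_min lexx orbT.
    rewrite gt_eqF ?ltrDl// opprD addrA subrr add0r normrN gtr0_norm//.
    by split => //; lra.
  exists (t - Num.min (T / 2) (e / 2)).
  have m0 : 0 < Num.min (T / 2) (e / 2) by rewrite lt_min !divr_gt0.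
  have mT : Num.min (T / 2) (e / 2) <= T / 2 by rewrite ge_min lexx.
  have me : Num.min (T / 2) (e / 2) <= e / 2 by rewrite ge_min lexx orbT.
  rewrite lt_eqF ?gtrBl// subKr gtr0_norm//.
  by split => //; lra.
by apply: (eP s) => //=; rewrite in_itv/= s0.
Qed.

Lemma dotP (f : R -> R) (t l : R) : 0 <= t <= T ->
  diff_quot f t s @[s --> within `[0, T] t^'] --> l ->
  derivable_in T f t /\ dot T f t = l.
Proof.
move=> tT fl; have FF := within_dnbhs_proper tT; split.
  by apply/cvg_ex; exists l.
exact: cvg_lim.
Qed.

(** Multiplying the quotient out makes s = t harmless and gives the shape of [has_deriv], now
    one-sided at T as well. *)
Lemma diff_quot_cvgP (f : R -> R) (t l : R) :
  diff_quot f t s @[s --> within `[0, T] t^'] --> l <->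
  forall e, 0 < e -> exists2 d, 0 < d & forall s, 0 <= s <= T -> `|s - t| <= d ->
    `|f s - f t - l * (s - t)| <= e * `|s - t|.
Proof.
split.
  move=> /cvgrPdist_le fl e /fl /= /nbhs_ballP[d /= d0 dP].
  exists (d / 2); first by rewrite divr_gt0.
  move=> s sT sd; have [->|st] := eqVneq s t.
    by rewrite !subrr mulr0 subr0 !normr0 mulr0.
  have st0 : s - t != 0 by rewrite subr_eq0.
  have : `|l - (f s - f t) / (s - t)| <= e.
    apply: (dP s) => //; rewrite /ball/= distrC (le_lt_trans sd)//.
    by rewrite ltr_pdivrMr// ltr_pMr// ltr1n.
  rewrite -(ler_pM2r (_ : 0 < `|s - t|)) ?normr_gt0// -normrM mulrBl divfK//.
  by rewrite distrC.
move=> fl; apply/cvgrPdist_le => e /fl[d d0 dP].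
apply/nbhs_ballP; exists d => //= s; rewrite /ball/= => sd st.
rewrite in_itv/= => sT.
have st0 : s - t != 0 by rewrite subr_eq0.
rewrite -(ler_pM2r (_ : 0 < `|s - t|)) ?normr_gt0// -normrM mulrBl divfK//.
by rewrite distrC dP// distrC ltW.
Qed.

Lemma derivable_diff_quot (f : R -> R) t : derivable f t 1 ->
  exists l : R, diff_quot f t s @[s --> within `[0, T] t^'] --> l.
Proof.
move=> df; exists ('D_1 f t); apply/diff_quot_cvgP => e e0.
have /cvgrPdist_le/(_ _ e0)/nbhs_ballP[d /= d0 dP] := df.
exists (d / 2); first by rewrite divr_gt0.
move=> s sT sd; have [->|st] := eqVneq s t.
  by rewrite !subrr mulr0 subr0 !normr0 mulr0.
have st0 : s - t != 0 by rewrite subr_eq0.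
have := dP (s - t); rewrite /ball/= sub0r normrN (le_lt_trans sd); last first.
  by rewrite ltr_pdivrMr// ltr_pMr// ltr1n.
move=> /(_ isT st0); rewrite -(ler_pM2r (_ : 0 < `|s - t|)) ?normr_gt0//.
rewrite -normrM mulrBl /GRing.scale/= mulr1 subrK mulrAC mulVf// mul1r.
by rewrite distrC.
Qed.

Lemma dot_le (f : R -> R) (t l k : R) : 0 <= t <= T ->
  (forall s r, 0 <= s -> s <= r -> r <= T -> f r - f s <= k * (r - s)) ->
  diff_quot f t s @[s --> within `[0, T] t^'] --> l -> l <= k.
Proof.
move=> tT fk fl; have FF := within_dnbhs_proper tT.
apply: (cvg_le_near fl) => e e0; rewrite near_withinE; near=> s => sT.
have st : s != t by near: s; exact: nbhs_dnbhs_neq.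
move: sT tT; rewrite /= in_itv/= /diff_quot => /andP[s0 sT] /andP[t0 tT].
have k1 : k <= k + e by rewrite lerDl ltW.
have [ts|ts] := ltP t s.
  rewrite ler_pdivrMr ?subr_gt0// (le_trans (fk _ _ _ (ltW ts) _))//.
  by rewrite ler_wpM2r// subr_ge0 ltW.
have ts' : s < t by rewrite lt_neqAle st.
rewrite -mulrNN -invrN !opprB ler_pdivrMr ?subr_gt0//.
rewrite (le_trans (fk _ _ _ (ltW ts') _))//.
by rewrite ler_wpM2r// subr_ge0 ltW.
Unshelve. all: by end_near. Qed.

End derivative_in.

(** * One follower *)

Lemma within_continuous_comp (X Y Z : topologicalType) (A : set Y)
    (f : Y -> Z) (g : X -> Y) :
  {within A, continuous f} -> continuous g -> (forall x, A (g x)) ->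
  continuous (f \o g).
Proof.
move=> /subspace_continuousP cf cg gA x P /(cf _ (gA x)) fP.
have gP : \forall y \near x, A (g y) -> P (f (g y)) := cg x _ fP.
rewrite -[_ P]/(\forall y \near x, P (f (g y))).
by apply: filterS gP => y; apply; exact: gA.
Qed.

Lemma C1_onP (R : realType) (T : R) (U : set R) (f g : R -> R) : 0 < T ->
  U `<=` `[0, T] ->
  (forall t, U t -> diff_quot f t s @[s --> within `[0, T] t^'] --> g t) ->
  {within U, continuous g} -> C1_on T U f.
Proof.
move=> T0 UT fg cg.
have dfg t : U t -> derivable_in T f t /\ dot T f t = g t.
  by move=> Ut; have := UT _ Ut; rewrite /= in_itv/= => tT; apply: dotP (fg _ Ut).
split=> [t /dfg[]//|].
by apply: subspace_eq_continuous cg => t; rewrite inE => /dfg[].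
Qed.

Lemma has_deriv_within_continuous (R : realType) (U : set R) (f : R -> R) :
  (forall t, U t -> 0 <= t /\ exists l, has_deriv f t l) ->
  {within U, continuous f}.
Proof.
move=> Uf; apply/subspace_continuousP => t /Uf[_ [l fl]].
have [d d0 dP] := fl _ (@ltr01 R).
apply/cvgrPdist_le => e e0; rewrite near_withinE; near=> s => /Uf[s0 _].
have L0 : 0 < 1 + `|l| by rewrite ltr_pwDl.
have sd : `|s - t| <= Num.min d (e / (1 + `|l|)).
  rewrite distrC; near: s; apply: cvgr_dist_le => //.
  by rewrite lt_min d0 divr_gt0.
move: sd; rewrite le_min => /andP[sd]; rewrite ler_pdivlMr// => se.
have := dP s s0 sd; rewrite mul1r => fs.
have -> : f t - f s = - (f s - f t - l * (s - t)) - l * (s - t) by ring.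
rewrite (le_trans (ler_normB _ _))// normrN normrM; lra.
Unshelve. all: by end_near. Qed.

(** Constancy on the right of t is enough: with tolerance |l| / 2, one test point at distance m
    would give |l| m <= |l| m / 2. *)
Lemma has_deriv_cst (R : realType) (f : R -> R) (t l d : R) : 0 <= t -> 0 < d ->
  has_deriv f t l -> (forall s, t <= s <= t + d -> f s = f t) -> l = 0.
Proof.
move=> t0 d0 fl fc; apply/eqP; rewrite -normr_eq0 eq_le normr_ge0 andbT leNgt.
apply/negP => l0; have [d' d'0 dP] := fl _ (divr_gt0 l0 (@ltr0n R 2)).
pose m := Num.min d d'; have m0 : 0 < m by rewrite lt_min d0.
have md : m <= d by rewrite ge_min lexx.
have md' : m <= d' by rewrite ge_min lexx orbT.
have := dP (t + m); rewrite addrAC subrr add0r (gtr0_norm m0) fc; last lra.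
rewrite subrr sub0r normrN normrM (gtr0_norm m0) => /(_ _ md')/wrap[]; first lra.
by rewrite ler_pM2r//; lra.
Qed.

Lemma le_sup_compact (R : realType) (X : topologicalType) (K : set X)
    (f : X -> R) x :
  compact K -> {within K, continuous f} -> K x -> f x <= sup (f @` K).
Proof.
move=> cK cf Kx; apply: ub_le_sup; last by exists x.
have /compact_bounded := continuous_compact cf cK.
move=> [r [_ rb]]; exists (r + 1) => _ [y Ky <-].
apply: le_trans (ler_norm _) _; apply: (rb (r + 1)); first by rewrite ltrDl.
by exists y.
Qed.

Lemma nbhs_dist_le (R : realType) (t : R) (P : set R) : nbhs t P ->
  exists2 d, 0 < d & forall s, `|s - t| <= d -> P s.
Proof.
move=> /nbhs_ballP[d /= d0 dP]; exists (d / 2); first by rewrite divr_gt0.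
move=> s sd; apply: dP; rewrite /ball/= distrC (le_lt_trans sd)//.
by rewrite ltr_pdivrMr// ltr_pMr// ltr1n.
Qed.

Lemma has_deriv_diff_quot (R : realType) (T t l : R) (f g : R -> R) :
  0 <= t <= T -> (\forall s \near t, 0 <= s <= T -> f s = g s) ->
  has_deriv g t l -> diff_quot f t s @[s --> within `[0, T] t^'] --> l.
Proof.
move=> tT fg gl; apply/diff_quot_cvgP => e /gl[d d0 dP].
have [d' d'0 {}fg] := nbhs_dist_le fg.
exists (Num.min d d'); first by rewrite lt_min d0.
move=> s /[dup] sT /andP[s0 _]; rewrite le_min => /andP[sd sd'].
by rewrite fg// fg ?subrr ?normr0 ?(ltW d'0)//; exact: dP.
Qed.

Section follower.
Context {R : realType}.
Variables (N : nat) (T eps gamma : R) (zeta theta : R -> R).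
Variables (rho_zeta rho_theta : R) (F : R * R -> R).
Hypotheses (hN : (1 <= N)%N) (hT : 0 < T) (heps : 0 < eps) (hgamma : 0 < gamma).
Hypothesis hFcont : {within `[0, T] `*` setT, continuous F}.
Hypothesis hFge0 : forall t y, t \in `[0, T] -> 0 <= F (t, y).
Hypothesis hzcont : {within `[0, +oo[, continuous zeta}.
Hypothesis hzge0 : forall r, 0 <= r -> 0 <= zeta r.
Hypothesis hthcont : {within `[0, +oo[, continuous theta}.
Hypothesis hthge0 : forall r, 0 <= r -> 0 <= theta r.
Hypotheses (hrz : 0 < rho_zeta) (hrth : rho_zeta <= rho_theta).
Hypothesis hz0 : forall r, 0 <= r -> (zeta r = 0 <-> rho_zeta <= r).
Hypothesis hth0 : forall r, 0 <= r -> (theta r = 0 <-> rho_theta <= r).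
Variables (ylo yhi : R) (l : R -> R) (p0 w : R).
Hypothesis hlcont : {within `[0, T], continuous l}.
Hypothesis hlmono : {in `[0, T] &, {homo l : s t / s <= t}}.
Hypotheses (hlhi : l T <= yhi) (hplo : ylo <= p0) (hpl : p0 < l 0).
Hypothesis hrho0 : (N%:R * (l 0 - p0))^-1 <= rho_theta.
Hypothesis hw : 0 <= w.

(** The box [ylo, yhi] is independent of the initial position [p0] and of [l], so that the same M
    serves every vehicle of the platoon. *)
Let M := sup (theta @` `[0, rho_theta]) / gamma *
  sup (F @` (`[0, T] `*` `[ylo, yhi])).

Definition gap_density (x : R -> R) (t : R) : R := (N%:R * (l t - x t))^-1.

(** The model restricted to one vehicle behind a given trajectory [l], in a form that passes down
    the platoon: the velocity bound appears as a Lipschitz constant, and strict monotonicity is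
    inherited from [l]. *)
Record follows (x : R -> R) : Prop := Follows {
  fo_init : x 0 = p0 ;
  fo_lip : forall s t, 0 <= s -> s <= t -> t <= T ->
    0 <= x t - x s <= Num.max w M * (t - s) ;
  fo_order : forall t, t \in `[0, T] ->
    x t < l t /\ gap_density x t <= rho_theta ;
  fo_free : let U := [set t | t \in `[0, T] /\ gap_density x t < rho_zeta] in
    C2_on T U x /\
    forall t, U t ->
      eps * zeta (gap_density x t) * dot T (dot T x) t + gamma * dot T x t
      = theta (gap_density x t) * F (t, x t) ;
  fo_congested :
    let U := [set t | t \in `[0, T] /\ rho_zeta < gap_density x t <= rho_theta]
      `|` @interior (subspace `[0, T])
            [set t | t \in `[0, T] /\ gap_density x t = rho_zeta] in
    C1_on T U x /\
    forall t, U t -> gamma * dot T x t = theta (gap_density x t) * F (t, x t) ;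
  fo_velocity : (N%:R * (l 0 - p0))^-1 < rho_zeta -> dot T x 0 = w ;
  fo_strict : {in `[0, T] &, {homo l : s t / s < t}} ->
    (forall t y, t \in `[0, T] -> 0 < F (t, y)) ->
    {in `[0, T] &, {homo x : s t / s < t}} }.

Let N0 : 0 < N%:R :> R. Proof. by rewrite ltr0n. Qed.
Let rth0 : 0 < rho_theta. Proof. exact: lt_le_trans hrth. Qed.
(** The gap at which the density reaches [rho_theta]; the wall is [l - dth]. *)
Let dth := (N%:R * rho_theta)^-1.
Let dth0 : 0 < dth. Proof. by rewrite invr_gt0 mulr_gt0. Qed.
Let dthE : N%:R * dth = rho_theta^-1.
Proof. by rewrite /dth invfM mulVKf// gt_eqF. Qed.
Let c := clamp 0 T.
Let c_cont : continuous c. Proof. exact: clamp_continuous (ltW hT). Qed.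
Let c_id t : 0 <= t <= T -> c t = t. Proof. exact: clamp_id. Qed.
Let c_in t : c t \in `[0, T].
Proof. by rewrite in_itv/=; exact: clamp_bnd (ltW hT) t. Qed.

Let l0T : l 0 <= l T.
Proof. by apply: hlmono; rewrite ?in_itv/= ?lexx ltW. Qed.

Let yy : ylo <= yhi.
Proof. by apply: le_trans hplo (le_trans (ltW hpl) (le_trans l0T hlhi)). Qed.

Let gap (p : R * R) := l (c p.1) - p.2.
(** With the truncated gap the density is continuous and lies in ]0, rho_theta] for every position.
    Beyond the wall it is frozen at [rho_theta], where zeta and theta both vanish. *)
Let dens p := (N%:R * Num.max (gap p) dth)^-1.
Let a p := eps / gamma * zeta (dens p).
(** Clamping the position bounds [h] by M everywhere; the solution stays in [ylo, yhi], so the clamp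
    is invisible to it. *)
Let h p := theta (dens p) / gamma * F (c p.1, clamp ylo yhi p.2).

Let dens_gt0 p : 0 < dens p.
Proof. by rewrite invr_gt0 mulr_gt0// lt_max dth0 orbT. Qed.

Let dens_le p : dens p <= rho_theta.
Proof.
rewrite /dens -[leRHS]invrK lef_pV2 ?posrE ?invr_gt0//; last first.
  by rewrite mulr_gt0// lt_max dth0 orbT.
by rewrite -dthE ler_pM2l// le_max lexx orbT.
Qed.

Let dens_wall p : gap p <= dth -> dens p = rho_theta.
Proof.
by move=> gd; rewrite /dens max_r// dthE invrK.
Qed.

Let fst_cont : continuous (@fst R R).
Proof. by move=> p; exact: (@cvg_fst _ _ (nbhs p.1) (nbhs p.2)). Qed.

Let snd_cont : continuous (@snd R R).
Proof. by move=> p; exact: (@cvg_snd _ _ (nbhs p.1) (nbhs p.2)). Qed.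

Let gap_cont : continuous gap.
Proof.
have cl : continuous (l \o c) by apply: within_continuous_comp hlcont c_cont c_in.
have cl1 : continuous ((l \o c) \o @fst R R).
  by move=> p; exact: (continuous_comp (@fst_cont p) (@cl p.1)).
move=> p; exact: (cvgB (@cl1 p) (@snd_cont p)).
Qed.

Let dens_cont : continuous dens.
Proof.
move=> p; apply: cvgV; first by rewrite gt_eqF// mulr_gt0// lt_max dth0 orbT.
apply: cvgM; first exact: cvg_cst.
by apply: (@continuous_max _ _ gap (cst dth)); [exact: gap_cont|exact: cvg_cst].
Qed.

Let a_cont : continuous a.
Proof.
move=> p; apply: cvgM; first exact: cvg_cst.
apply: (within_continuous_comp hzcont dens_cont) => q.
by rewrite /= in_itv/= andbT ltW.
Qed.

Let h_cont : continuous h.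
Proof.
move=> p; apply: cvgM.
  apply: cvgM; last exact: cvg_cst.
  apply: (within_continuous_comp hthcont dens_cont) => q.
  by rewrite /= in_itv/= andbT ltW.
apply: (within_continuous_comp (g := fun p => (c p.1, clamp ylo yhi p.2)) hFcont).
  move=> q.
  have c1 : c r.1 @[r --> q] --> c q.1.
    exact: (continuous_comp (@fst_cont q) (@c_cont q.1)).
  have c2 : clamp ylo yhi r.2 @[r --> q] --> clamp ylo yhi q.2.
    exact: (continuous_comp (@snd_cont q) (@clamp_continuous _ _ _ yy q.2)).
  exact: cvg_pair c1 c2.
by move=> q; split => //=; exact: c_in.
Qed.

Let a_ge0 p : 0 <= a p.
Proof. by rewrite mulr_ge0 ?divr_ge0 ?hzge0// ltW. Qed.

Let h_bnd p : 0 <= h p <= M.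
Proof.
rewrite mulr_ge0 ?divr_ge0 ?hthge0 ?hFge0 ?(ltW hgamma) ?(ltW (dens_gt0 _))//=.
apply: ler_pM; rewrite ?divr_ge0 ?hthge0 ?hFge0 ?(ltW hgamma) ?(ltW (dens_gt0 _))//.
  rewrite ler_pM2r ?invr_gt0//; apply: le_sup_compact.
  - exact: segment_compact.
  - apply: continuous_subspaceW hthcont => r /=.
    by rewrite !in_itv/= andbT => /andP[].
  - by rewrite /= in_itv/= dens_le ltW.
apply: le_sup_compact.
- by apply: compact_setX; exact: segment_compact.
- by apply: continuous_subspaceW hFcont => -[? ?] [].
- by split; [exact: c_in|rewrite /= in_itv/=; exact: clamp_bnd].
Qed.

Section solution.
Variables x v : R -> R.
Hypothesis xv : degenerate_solution a h p0 w (Num.max w M) x v.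

(** The trajectory x is controlled only at nonnegative times; y is continuous on the line and agrees
    with x on [0, T]. *)
Let y t := x (c t).
Let rho t := dens (t, y t).
Let al t := a (t, y t).
Let et t := h (t, y t).

Let y_cont : continuous y.
Proof.
apply: (nondecreasing_klipschitz_continuous (k := Num.max w M)).
by apply: clamp_klipschitz => // s t s0 st _; exact: (ds_lip xv).
Qed.

Let ty_cont : continuous (fun t => (t, y t)).
Proof. by move=> t; exact: (cvg_pair (@cvg_id _ (nbhs t)) (@y_cont t)). Qed.

Let rho_cont : continuous rho.
Proof. by move=> t; exact: (continuous_comp (@ty_cont t) (@dens_cont _)). Qed.

Let al_cont : continuous al.
Proof. by move=> t; exact: (continuous_comp (@ty_cont t) (@a_cont _)). Qed.

Let et_cont : continuous et.
Proof. by move=> t; exact: (continuous_comp (@ty_cont t) (@h_cont _)). Qed.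

Let yE t : 0 <= t <= T -> y t = x t.
Proof. by move=> tT; rewrite /y c_id. Qed.

Let zeta0 : zeta rho_theta = 0.
Proof. by apply/hz0 => //; exact: ltW. Qed.

Let theta0 : theta rho_theta = 0.
Proof. by apply/hth0 => //; exact: ltW. Qed.

(** The wall is nondecreasing because [l] is, and both coefficients vanish from it on, so
    [ds_barrier] applies; the initial bound on the density says that the vehicle starts behind it.
    Hence the truncation of the gap never acts on the solution. *)
Let gap_ge t : 0 <= t <= T -> dth <= l t - x t.
Proof.
move=> tT; suff : x t <= l (c t) - dth by rewrite c_id// => ?; lra.
have /andP[t0 _] := tT; apply: (ds_barrier xv (b := fun t => l (c t) - dth)) t0.
- move=> s r _ _ sr; rewrite lerB// hlmono//.
  by have /andP[+ _] := clamp_lip (ltW hT) sr; rewrite subr_ge0.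
- move=> s r s0 br; have wall : dens (s, r) = rho_theta.
    by apply: dens_wall; rewrite /gap/=; lra.
  by rewrite /a /h wall zeta0 theta0 mulr0 !mul0r.
- rewrite c_id; last by rewrite lexx ltW.
  suff : dth <= l 0 - p0 by move=> ?; lra.
  rewrite -(ler_pM2l N0) dthE -lef_pV2 ?invrK ?posrE ?invr_gt0//.
  by rewrite mulr_gt0// subr_gt0.
Qed.

Let x_lt t : 0 <= t <= T -> x t < l t.
Proof. by move=> /gap_ge tT; rewrite -subr_gt0 (lt_le_trans dth0). Qed.

Let rhoE t : 0 <= t <= T -> gap_density x t = rho t.
Proof.
by move=> tT; rewrite /rho /dens /gap/= yE// c_id// max_l//; exact: gap_ge.
Qed.

Let in0T t : (t \in `[0, T]) = (0 <= t <= T). Proof. by rewrite in_itv. Qed.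

Let x_bnd t : 0 <= t <= T -> ylo <= x t <= yhi.
Proof.
move=> /[dup] tT /andP[t0 tT'].
have /andP[+ _] := ds_lip xv (lexx 0) t0; rewrite (ds_pos0 xv) => x0.
have xl := x_lt tT.
have : l t <= l T by apply: hlmono; rewrite ?in0T ?tT ?lexx ?(ltW hT).
by move: hplo hlhi => ? ? ?; apply/andP; split; lra.
Qed.

Let alE t : 0 <= t <= T -> al t = eps / gamma * zeta (gap_density x t).
Proof. by move=> tT; rewrite /al /a rhoE. Qed.

Let etE t : 0 <= t <= T -> et t = theta (gap_density x t) / gamma * F (t, x t).
Proof.
by move=> tT; rewrite /et /h rhoE// /rho/= yE// c_id// clamp_id//; exact: x_bnd.
Qed.

(** As zeta vanishes exactly from [rho_zeta] on, the free phase of the model is the region where the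
    equation is nondegenerate. *)
Let al_gt0 t : 0 <= t <= T -> (0 < al t) = (gap_density x t < rho_zeta).
Proof.
move=> tT; rewrite alE// pmulr_rgt0 ?divr_gt0// rhoE//.
have d0 := ltW (dens_gt0 (t, y t)).
rewrite lt_neqAle hzge0// andbT eq_sym ltNge; congr (~~ _).
by apply/eqP/idP => /hz0; apply.
Qed.

Let al_eq0 t : 0 <= t <= T -> rho_zeta <= gap_density x t -> al t = 0.
Proof.
by move=> tT; rewrite leNgt -al_gt0// lt_neqAle a_ge0 andbT negbK => /eqP.
Qed.

Let xv_free t : 0 <= t <= T -> 0 < al t ->
  has_deriv x t (v t) /\ has_deriv v t ((et t - v t) / al t).
Proof.
by move=> tT; rewrite /al /et yE// => ?; apply: (ds_free xv) => //; case/andP: tT.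
Qed.

Let free_dot t : 0 <= t <= T -> 0 < al t ->
  diff_quot x t s @[s --> within `[0, T] t^'] --> v t.
Proof.
move=> tT at0; apply: (has_deriv_diff_quot tT) (xv_free tT at0).1.
exact: filterE.
Qed.

Let dotE t : 0 <= t <= T -> 0 < al t -> dot T x t = v t.
Proof. by move=> tT /free_dot /(dotP hT tT)[]. Qed.

Let free_ddot t : 0 <= t <= T -> 0 < al t ->
  diff_quot (dot T x) t s @[s --> within `[0, T] t^'] --> (et t - v t) / al t.
Proof.
move=> tT at0; apply: (has_deriv_diff_quot tT) (xv_free tT at0).2.
(* The derivative of x is known to be v only where [al] is positive, but that set is a neighbourhood
   of t. *)
near=> s => sT; apply: dotE => //; near: s.
exact: (@al_cont t _ (lt_nbhsr at0)).
Unshelve. all: by end_near. Qed.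

(** On a window where [al] vanishes and [et] stays within e of [et t], the integrated equation is
    exactly the estimate that defines the derivative. *)
Let congested_dot t : 0 <= t <= T ->
  (\forall s \near t, 0 <= s <= T -> al s = 0) ->
  diff_quot x t s @[s --> within `[0, T] t^'] --> et t.
Proof.
move=> tT /nbhs_dist_le[d d0 al0]; apply/diff_quot_cvgP => e e0.
have /cvgrPdist_le/(_ _ e0)/nbhs_dist_le[d' d'0 ete] := @et_cont t.
exists (Num.min d d'); first by rewrite lt_min d0.
have main r s : 0 <= r -> r <= s -> s <= T -> `|r - t| <= Num.min d d' ->
    `|s - t| <= Num.min d d' -> `|x s - x r - et t * (s - r)| <= e * (s - r).
  move=> r0 rs sT rd sd; apply: (ds_congested xv) => //; first exact: ltW.
  move=> q /andP[rq qs].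
  have qT : 0 <= q <= T by rewrite (le_trans r0)//= (le_trans qs).
  have : `|q - t| <= Num.min d d'.
    by move: rd sd; rewrite !ler_norml => /andP[? ?] /andP[? ?]; apply/andP; split; lra.
  rewrite le_min => /andP[qd qd']; split; first by rewrite -yE//; exact: al0.
  by rewrite -yE// distrC; exact: ete.
have t0 : `|t - t| <= Num.min d d' by rewrite subrr normr0 le_min !ltW.
move: tT => /andP[t0' tT] s /andP[s0 sT] sd; have [st|ts] := leP s t.
  have := main s t s0 st tT sd t0; rewrite (distrC s) (@ger0_norm _ (t - s)) ?subr_ge0//.
  move=> /(le_trans _); apply; rewrite -normrN le_eqVlt; apply/orP; left.
  by apply/eqP; congr `|_|; ring.
have := main t s t0' (ltW ts) sT t0 sd.
by rewrite (@ger0_norm _ (s - t)) ?subr_ge0// ltW.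
Qed.

(** If x s = x t with s < t, then x is constant on [s, t] while [l] moves away, so the force [et] is
    positive after s. Where [al] > 0 the velocity would vanish with positive acceleration; hence
    [al] = 0 on ]s, t[, and there x' = [et] > 0, a contradiction. *)
Let strict : {in `[0, T] &, {homo l : s t / s < t}} ->
  (forall t y, t \in `[0, T] -> 0 < F (t, y)) ->
  {in `[0, T] &, {homo x : s t / s < t}}.
Proof.
move=> lst Fpos s t; rewrite !in0T => /andP[s0 sT] /andP[t0 tT] st.
have xm r r' : 0 <= r -> r <= r' -> x r <= x r'.
  by move=> r0 rr'; have /andP[+ _] := ds_lip xv r0 rr'; rewrite subr_ge0.
rewrite lt_neqAle xm ?(ltW st)// andbT; apply/eqP => xst.
have xc r : s <= r <= t -> x r = x s.
  move=> /andP[sr rt]; apply/eqP; rewrite eq_le (xm s r)// andbT xst xm//.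
  exact: le_trans sr.
(* The time s is excluded: the gap may equal [dth] there, and theta then vanishes. *)
have et0 r : s < r <= t -> 0 < et r.
  move=> /andP[sr rt]; have rT : 0 <= r <= T.
    by rewrite (le_trans s0 (ltW sr)) (le_trans rt).
  rewrite etE// mulr_gt0 ?Fpos ?in0T// divr_gt0//.
  have rr : gap_density x r < rho_theta.
    have gs : dth <= l s - x s by apply: gap_ge; rewrite s0.
    have lsr : l s < l r by apply: lst; rewrite ?in0T ?s0.
    have gr : dth < l r - x r by rewrite xc ?(ltW sr)//; lra.
    rewrite /gap_density -[ltRHS]invrK ltf_pV2 ?posrE ?invr_gt0//; last first.
      by rewrite mulr_gt0// (lt_trans dth0).
    by rewrite -dthE ltr_pM2l.
  have d0 : 0 <= gap_density x r by rewrite rhoE// (ltW (dens_gt0 _)).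
  rewrite lt_neqAle hthge0// andbT eq_sym; apply/eqP => /(hth0 d0).
  by rewrite leNgt rr.
have al0 m : s < m < t -> al m = 0.
  move=> /andP[sm mt]; apply/eqP; rewrite eq_le a_ge0 andbT leNgt.
  apply/negP => am.
  have mT : 0 <= m <= T by apply/andP; split; lra.
  have etm : 0 < et m by rewrite et0// sm ltW.
  have v0 r : m <= r < t -> 0 < al r -> v r = 0.
    move=> /andP[mr rt] ar; have rT : 0 <= r <= T by apply/andP; split; lra.
    have [xd _] := xv_free rT ar.
    apply: (@has_deriv_cst _ x r _ (t - r)) => //; first lra.
      by rewrite subr_gt0.
    by move=> q /andP[rq qt]; rewrite !xc//; apply/andP; split; lra.
  have /nbhs_dist_le[d d0 ald] : \forall r \near m, 0 < al r.
    exact: (@al_cont m _ (lt_nbhsr am)).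
  pose d' := Num.min d ((t - m) / 2).
  have d'd : d' <= d by rewrite ge_min lexx.
  have d't : d' <= (t - m) / 2 by rewrite ge_min lexx orbT.
  have d'0 : 0 < d' by rewrite lt_min d0 divr_gt0// subr_gt0.
  (* v vanishes on a right neighbourhood of m, so its derivative at m is zero. *)
  have : (et m - v m) / al m = 0.
    apply: (has_deriv_cst _ d'0 (xv_free mT am).2); first lra.
    move=> q /andP[mq qd]; rewrite !v0//; first by rewrite lexx.
      by apply/andP; split; lra.
    by apply: ald; rewrite ger0_norm; lra.
  rewrite v0 ?lexx ?mt// subr0 => /eqP.
  by rewrite mulf_eq0 invr_eq0 !gt_eqF.
pose m := (s + t) / 2.
have [sm mt] : s < m /\ m < t by rewrite /m; split; lra.
have etm : 0 < et m by rewrite et0// sm ltW.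
have etm2 : 0 < et m / 2 by rewrite divr_gt0.
have /cvgrPdist_le/(_ _ etm2)/nbhs_dist_le[d d0 ete] := @et_cont m.
pose d' := Num.min d ((t - m) / 2).
have d'd : d' <= d by rewrite ge_min lexx.
have d't : d' <= (t - m) / 2 by rewrite ge_min lexx orbT.
have d'0 : 0 < d' by rewrite lt_min d0 divr_gt0// subr_gt0.
(* With tolerance [et m / 2] the integrated equation forces a displacement of at least d' [et m] /
   2, against constancy. *)
have : `|x (m + d') - x m - et m * (m + d' - m)| <= et m / 2 * (m + d' - m).
  apply: (ds_congested xv); [lra|lra|exact: ltW|].
  move=> r /andP[mr rm]; rewrite -yE; last by apply/andP; split; lra.
  split; first by apply: al0; apply/andP; split; lra.
  by rewrite distrC ete// ger0_norm; lra.
have -> : m + d' - m = d' by ring.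
rewrite !xc; [|apply/andP; split; lra..].
rewrite subrr sub0r normrN normrM (gtr0_norm etm) (gtr0_norm d'0) ler_pM2r//.
by move=> ?; lra.
Qed.

Lemma degenerate_solution_follows : follows x.
Proof.
split.
- exact: ds_pos0 xv.
- by move=> s t s0 st _; exact: (ds_lip xv).
- by move=> t; rewrite in0T => tT; rewrite x_lt// rhoE// dens_le.
- have UT : [set t | t \in `[0, T] /\ gap_density x t < rho_zeta] `<=` `[0, T].
    by move=> t [].
  have Ual t : t \in `[0, T] /\ gap_density x t < rho_zeta ->
      0 <= t <= T /\ 0 < al t.
    by rewrite in0T => -[tT]; rewrite -al_gt0.
  have v_cont : {within [set t | t \in `[0, T] /\ gap_density x t < rho_zeta],
      continuous v}.
    apply: has_deriv_within_continuous => t /Ual[tT at0].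
    have /andP[t0 _] := tT; split=> //; exists ((et t - v t) / al t).
    exact: (xv_free tT at0).2.
  split; last first.
    move=> t [+ rt]; rewrite in0T => tT.
    have at0 : 0 < al t by rewrite al_gt0.
    have [_ ->] := dotP hT tT (free_ddot tT at0).
    rewrite dotE// etE//; move: at0; rewrite alE// => at0.
    have z0 : 0 < zeta (gap_density x t).
      by move: at0; rewrite pmulr_rgt0// divr_gt0.
    by field; rewrite !gt_eqF.
  split.
    by apply: (C1_onP hT UT _ v_cont) => t /Ual[tT at0]; exact: free_dot.
  apply: (@C1_onP _ _ _ _ (fun t => (et t - v t) / al t)) => //.
    by move=> t /Ual[tT at0]; exact: free_ddot.
  apply/subspace_continuousP => t Ut; have [tT at0] := Ual t Ut.
  apply: cvgM.
    apply: cvgB; last by move/subspace_continuousP: v_cont; exact.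
    by apply: cvg_within_filter; exact: (@et_cont t).
  apply: cvgV; first by rewrite gt_eqF.
  by apply: cvg_within_filter; exact: (@al_cont t).
- set U := _ `|` _.
  have UT t : U t -> 0 <= t <= T.
    rewrite -in0T => -[[]//|/interior_subset[]//].
  (* On both pieces of U the coefficient vanishes near t: the strict inequality persists by
     continuity of the density, and on the second piece this is what the interior relative to [0, T]
     says. *)
  have Ual t : U t -> \forall s \near t, 0 <= s <= T -> al s = 0.
    move=> [[+ /andP[rt _]]|].
      rewrite in0T => tT; rewrite rhoE// in rt; near=> s => sT.
      apply: al_eq0 => //; rewrite rhoE// ltW//; near: s.
      exact: (@rho_cont t _ (lt_nbhsr rt)).
    move=> /[dup] /interior_subset[tT _].
    move=> tU; have : \forall s \near t, `[0, T]%classic s ->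
        s \in `[0, T] /\ gap_density x s = rho_zeta.
      have : within `[0, T] (nbhs t)
          [set s | s \in `[0, T] /\ gap_density x s = rho_zeta].
        by rewrite nbhs_subspace_in//; exact: tU.
      exact.
    apply: filterS => s sP sT; have [|_ rs] := sP; first by rewrite /= in0T.
    by apply: al_eq0 => //; rewrite rs.
  have Udot t : U t -> diff_quot x t s @[s --> within `[0, T] t^'] --> et t.
    by move=> Ut; apply: congested_dot; [exact: UT|exact: Ual].
  split.
    apply: (C1_onP hT _ Udot); first by move=> t /UT; rewrite -in0T.
    exact: continuous_subspaceT.
  move=> t Ut; have tT := UT _ Ut; have [_ ->] := dotP hT tT (Udot _ Ut).
  by rewrite etE//; field; rewrite gt_eqF.
- move=> r0; have T0 : (0 : R) <= 0 <= T by rewrite lexx ltW.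
  rewrite dotE//; first exact: ds_vel0 xv.
  by rewrite al_gt0// /gap_density (ds_pos0 xv).
- exact: strict.
Unshelve. all: by end_near. Qed.
End solution.

Theorem follows_exists : exists x, follows x.
Proof.
have [x [v xv]] := degenerate_solution_exists p0 a_cont h_cont a_ge0 h_bnd hw.
by exists x; exact: degenerate_solution_follows xv.
Qed.

End follower.

(** * The platoon *)

(** Dependent choice running from N down to 0: a choice function on pairs (index, element ahead) is
    iterated from [aN], with an arbitrary value where the invariant [Q] fails. *)
Lemma backward_chain (A : Type) (N : nat) (P : nat -> A -> A -> Prop)
    (Q : nat -> A -> Prop) (aN : A) :
  Q N aN ->
  (forall j b, (j < N)%N -> Q j.+1 b -> exists2 c, P j b c & Q j c) ->
  exists2 X : nat -> A, X N = aN &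
    forall j, (j < N)%N -> Q j.+1 (X j.+1) /\ P j (X j.+1) (X j).
Proof.
move=> QN step.
have /choice[S SP] (jb : nat * A) : exists c, (jb.1 < N)%N -> Q jb.1.+1 jb.2 ->
    P jb.1 jb.2 c /\ Q jb.1 c.
  have [[jN Qj]|nQ] := pselect ((jb.1 < N)%N /\ Q jb.1.+1 jb.2).
    by have [c Pc Qc] := step _ _ jN Qj; exists c.
  by exists aN => jN Qj; case: nQ.
(* [Y m] is the element of index N - m, obtained after m steps from the leader. *)
pose Y m := iteri m (fun m b => S ((N - m.+1)%N, b)) aN.
have YQ m : (m <= N)%N -> Q (N - m)%N (Y m).
  elim: m => [|m IH] mN; first by rewrite subn0.
  have := SP ((N - m.+1)%N, Y m); rewrite /= subnSK//.
  by move=> /(_ ltac:(lia) (IH (ltnW mN)))[].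
exists (fun j => Y (N - j)%N); first by rewrite subnn.
move=> j jN; have := YQ (N - j.+1)%N (leq_subr _ _); rewrite subKn// => Qj.
have [+ _] := SP (j, Y (N - j.+1)%N) jN Qj; rewrite -(subnSK jN)/=.
by have -> : (N - (N - j.+1).+1 = j)%N by lia.
Qed.

Lemma row_norm_le (R : realType) (n : nat) (u : 'rV[R]_n) (b : R) :
  0 <= b -> (forall j, `|u ord0 j| <= b) -> `|u| <= b.
Proof.
move=> b0 ub; rewrite -[`|u|]/(mx_norm u).
have [->//|/mx_norm_neq0[[i j] ->]] := eqVneq (mx_norm u) 0.
by rewrite /= (ord1 i).
Qed.

Lemma positionsE (R : realType) (N : nat) (X : nat -> R -> R) (xN : R -> R) t :
  X N = xN ->
  positions (fun t => \row_(i < N) X i t) xN t = (fun j : 'I_N.+1 => X j t).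
Proof.
move=> XN; apply/funext => j; rewrite /positions.
by case: unliftP => [i ->|->]; [rewrite mxE lift_max|rewrite -XN].
Qed.

Unset Implicit Arguments.
Set Strict Implicit.
Set Printing Implicit Defensive.

Theorem theorem2p4 (R : realType) (N : nat) (T eps gamma : R)
    (zeta theta : R -> R) (rho_zeta rho_theta : R) (F : R * R -> R)
    (x0 : 'I_N.+1 -> R) (v0 : 'I_N -> R) (xN : R -> R)
    (hN : (1 <= N)%N) (hT : 0 < T) (heps : 0 < eps) (hgamma : 0 < gamma)
    (hFcont : {within `[0, T] `*` setT, continuous F})
    (hFge0 : forall t y, t \in `[0, T] -> 0 <= F (t, y))
    (hzcont : {within `[0, +oo[, continuous zeta})
    (hzge0 : forall r, 0 <= r -> 0 <= zeta r)
    (hthcont : {within `[0, +oo[, continuous theta})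
    (hthge0 : forall r, 0 <= r -> 0 <= theta r)
    (hrz : 0 < rho_zeta) (hrth : rho_zeta <= rho_theta)
    (hz0 : forall r, 0 <= r -> (zeta r = 0 <-> rho_zeta <= r))
    (hth0 : forall r, 0 <= r -> (theta r = 0 <-> rho_theta <= r))
    (hx0 : forall i : 'I_N, x0 (widen_ord (leqnSn N) i) < x0 (lift ord0 i))
    (hrho0 : forall i : 'I_N, density x0 i <= rho_theta)
    (hv0 : forall i : 'I_N, ~~ in_Sigma0 rho_zeta rho_theta x0 i -> 0 <= v0 i)
    (hxNcont : {within `[0, T], continuous xN})
    (hxNmono : {in `[0, T] &, {homo xN : s t / s <= t}})
    (hxN0 : xN 0 = x0 ord_max) :
  exists x : R -> 'rV[R]_N,
    [/\ is_solution T eps gamma zeta theta rho_zeta rho_theta F x0 v0 xN x,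
        (forall i : 'I_N, {ae (@lebesgue_measure R), forall t, t \in `]0, T[ ->
           derivable_in T (fun s => x s ord0 i) t /\
           dot T (fun s => x s ord0 i) t
             <= velocity_bound T gamma theta rho_zeta rho_theta F x0 v0 xN i})
      & {in `[0, T] &, {homo xN : s t / s < t}} ->
        (forall t y, t \in `[0, T] -> 0 < F (t, y)) ->
        forall i : 'I_N,
          {in `[0, T] &, {homo (fun t => x t ord0 i) : s t / s < t}}].
Proof.
have in0T t : (t \in `[0, T]) = (0 <= t <= T) by rewrite in_itv.
have x0_ge (k : 'I_N.+1) : x0 ord0 <= x0 k.
  case: k; elim=> [|k IH] kN; first by rewrite le_eqVlt; apply/orP; left;
    apply/eqP; congr x0; exact: val_inj.
  have kN' : (k < N)%N by [].
  apply: le_trans (IH (ltnW kN)) _.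
  have := ltW (hx0 (Ordinal kN')); set u := widen_ord _ _; set u' := lift _ _.
  have -> : u = Ordinal (ltnW kN) by exact: val_inj.
  by have -> : u' = Ordinal kN by exact: val_inj.
have vt0 i : 0 <= vtilde rho_zeta rho_theta x0 v0 i.
  by rewrite /vtilde; case: ifPn => // /hv0.
(* Chains are indexed by natural numbers; quantifying over the ordinals equal to j avoids carrying a
   proof of j < N. *)
pose P (j : nat) (l x : R -> R) := forall i : 'I_N, i = j :> nat ->
  follows N T eps gamma zeta theta rho_zeta rho_theta F (x0 ord0) (xN T) l
    (x0 (widen_ord (leqnSn N) i)) (vtilde rho_zeta rho_theta x0 v0 i) x.
(* The invariant collects what [follows_exists] asks of the trajectory ahead; the bound by [xN T]
   keeps every vehicle in the common box. *)
pose Q (j : nat) (l : R -> R) := [/\ {within `[0, T], continuous l},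
  {in `[0, T] &, {homo l : s t / s <= t}}, l T <= xN T &
  forall k : 'I_N.+1, k = j :> nat -> l 0 = x0 k].
have [||X XN XP] := @backward_chain (R -> R) N P Q xN.
- split => // k kN; rewrite hxN0; congr x0; apply: val_inj; exact/esym.
- move=> j l jN [lc lm lT l0]; pose i := Ordinal jN.
  have l0i : l 0 = x0 (lift ord0 i) by apply: l0; rewrite lift0.
  have [x fx] : exists x, follows N T eps gamma zeta theta rho_zeta rho_theta F
      (x0 ord0) (xN T) l (x0 (widen_ord (leqnSn N) i))
      (vtilde rho_zeta rho_theta x0 v0 i) x.
    by apply: follows_exists => //; rewrite l0i//; exact: hrho0.
  exists x; first by move=> i' i'j; have -> : i' = i by exact: val_inj.
  split; first exact: klipschitz_within_continuous hT (fo_lip fx).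
  + move=> s t; rewrite !in0T => /andP[s0 _] /andP[_ tT] st.
    by have /andP[+ _] := fo_lip fx s0 st tT; rewrite subr_ge0.
  + have TT : T \in `[0, T] by rewrite in0T lexx ltW.
    by have [xl _] := fo_order fx TT; exact: le_trans (ltW xl) lT.
  + move=> k kj; rewrite (fo_init fx); congr x0; apply: val_inj.
    exact/esym.
have XF (i : 'I_N) := (XP i (ltn_ord i)).2 i erefl.
have X0 (i : 'I_N) : X i.+1 0 = x0 (lift ord0 i).
  by have [[_ _ _ l0] _] := XP i (ltn_ord i); apply: l0; rewrite lift0.
pose x t := \row_(i < N) X i t.
have xE (i : 'I_N) : (fun t => x t ord0 i) = X i by apply/funext => t; rewrite mxE.
have rhoE (i : 'I_N) t : density (positions x xN t) i = gap_density N (X i.+1) (X i) t.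
  by rewrite positionsE// /density lift0.
have rhoE0 (i : 'I_N) :
    (N%:R * (X i.+1 0 - x0 (widen_ord (leqnSn N) i)))^-1 = density x0 i.
  by rewrite X0.
exists x; split.
- split.
  + pose V (i : 'I_N) := Num.max (vtilde rho_zeta rho_theta x0 v0 i)
      (sup (theta @` `[0, rho_theta]) / gamma *
       sup (F @` (`[0, T] `*` `[x0 ord0, xN T]))).
    have V0 i : 0 <= V i by rewrite le_max vt0.
    (* Rows carry the sup norm, and the sum of the nonnegative constants dominates each of them. *)
    exists (\sum_i V i) => -[t s] [/= tT sT].
    apply: row_norm_le => [|j]; first by rewrite mulr_ge0 ?sumr_ge0.
    apply: (@le_trans _ _ (V j * `|t - s|)); last first.
      by rewrite ler_wpM2r// (bigD1 j)//= lerDl sumr_ge0.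
    rewrite !mxE; move: tT sT; rewrite /= !in_itv/=.
    wlog st : s t / s <= t => [th|] /andP[t0 tT] /andP[s0 sT].
      have [st|/ltW ts] := leP s t; first by apply: th => //; apply/andP.
      by rewrite distrC (distrC t); apply: th => //; apply/andP.
    have /andP[l0 l1] := fo_lip (XF j) s0 st tT.
    by rewrite (ger0_norm l0) ger0_norm ?subr_ge0.
  + move=> i; have := fo_init (XF i); rewrite -xE; exact.
  + move=> i s t; rewrite !mxE !in0T => /andP[s0 _] /andP[_ tT] st.
    by have /andP[+ _] := fo_lip (XF i) s0 st tT; rewrite subr_ge0.
  + move=> i t tT; rewrite rhoE positionsE// lift0 mxE; exact: (fo_order (XF i)).
  + move=> i xi rho U; have xiE : xi = X i := xE i.
    have rE : rho = gap_density N (X i.+1) (X i) by apply/funext => t; exact: rhoE.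
    by rewrite /U rE xiE; exact: fo_free (XF i).
  + move=> i xi rho U; have xiE : xi = X i := xE i.
    have rE : rho = gap_density N (X i.+1) (X i) by apply/funext => t; exact: rhoE.
    by rewrite /U rE xiE; exact: fo_congested (XF i).
  (* As the initial density is at most [rho_theta], being outside Sigma^0 means that it is below
     [rho_zeta]. *)
  + move=> i iS; have := fo_velocity (XF i); rewrite rhoE0 xE /vtilde (negbTE iS).
    apply; move: iS; rewrite /in_Sigma0 hrho0 andbT; by rewrite ltNge.
- move=> i; rewrite xE.
  have := lipschitz_nondecreasing_ae_derivable hT (fo_lip (XF i)).
  apply: filterS; first exact: (ae_filter_ringOfSetsType lebesgue_measure).
  move=> t dt /[dup] /dt/(derivable_diff_quot T)[l dl].
  rewrite in_itv/= => /andP[t0 tT]; have tT' : 0 <= t <= T by rewrite !ltW.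
  have [d1 ->] := dotP hT tT' dl; split => //.
  apply: (dot_le hT tT' _ dl) => s r s0 sr rT.
  by have /andP[] := fo_lip (XF i) s0 sr rT.
- move=> xNs Fs i.
  (* Strict monotonicity travels backwards from the leader, by induction on the distance m to it. *)
  have Xs : forall m, (m <= N)%N -> {in `[0, T] &, {homo X (N - m)%N : s t / s < t}}.
    elim=> [|m IH] mN; first by rewrite subn0 XN.
    have jN : (N - m.+1 < N)%N by lia.
    apply: (fo_strict (XF (Ordinal jN))) => //=.
    by rewrite subnSK//; apply: IH; exact: ltnW.
  have := Xs (N - i)%N (leq_subr _ _); rewrite subKn ?(ltnW (ltn_ord i))// => Xi.
  by move=> s t sT tT st; rewrite !mxE; exact: Xi.
Qed.
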